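(* In the symmetric-ordering setup, for every $\mu$ and every $P\ge1$, the homogeneous component of total degree $P$ of $\Delta(\partial^\mu)$ equals $D^\mu_P(\partial\otimes1,1\otimes\partial)$, i.e. the polynomial $D^\mu_P(k,q)$ with $k^\alpha$ replaced by $\partial^\alpha\otimes1$ and $q^\alpha$ by $1\otimes\partial^\alpha$. Consequently $\Delta(\partial^\mu)=\sum_{P\ge1}D^\mu_P(\partial\otimes1,1\otimes\partial)$.
   Context: Symmetric-ordering setup: $\Bbbk$ is a field of characteristic $0$, $\mathfrak g$ an $n$-dimensional Lie algebra with basis $\hat x_1,\ldots,\hat x_n$; $S(\mathfrak g)=\Bbbk[x_1,\ldots,x_n]$ and $\partial^\mu$ acts on $S(\mathfrak g)$ as $\partial/\partial x_\mu$. The coexponential map $\xi:S(\mathfrak g)\to U(\mathfrak g)$ is the linear isomorphism $\xi(x_{\alpha_1}\cdots x_{\alpha_k})=\frac1{k!}\sum_{\sigma\in\Sigma_k}\hat x_{\alpha_{\sigma(1)}}\cdots\hat x_{\alpha_{\sigma(k)}}$; $f\star g=\xi^{-1}(\xi(f)\xi(g))$. The deformed coproduct $\Delta(\partial^\mu)$ is the unique formal power series $\sum_{I,J}c_{IJ}\partial^I\otimes\partial^J$ in the commuting variables $\partial^\alpha\otimes1,1\otimes\partial^\alpha$ with $\partial^\mu(f\star g)=\sum c_{IJ}(\partial^If)\star(\partial^Jg)$ for all $f,g\in S(\mathfrak g)$. Hausdorff series: $\log(e^Xe^Y)=\sum_{P\ge1}H_P(X,Y)$ with $H_P$ the homogeneous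 Lie polynomial of degree $P$ (rational coefficients) in the free Lie algebra on $X,Y$. With commuting indeterminates $k^1,\ldots,k^n,q^1,\ldots,q^n$, set $K=\sum_\alpha k^\alpha\hat x_\alpha$, $Q=\sum_\alpha q^\alpha\hat x_\alpha$ in $\mathfrak g\otimes\Bbbk[k,q]$, and define polynomials $D^\mu_P(k,q)$ by $H_P(K,Q)=\sum_\mu D^\mu_P(k,q)\hat x_\mu$. *)

(* Defs.v *)
From HB Require Import structures.
From mathcomp Require Import all_boot all_order all_algebra all_fingroup.
From mathcomp Require Export mpoly.
From Stdlib Require Import ClassicalEpsilon.
Set Implicit Arguments. Unset Strict Implicit. Unset Printing Implicit Defensive.
Import Order.TTheory GRing.Theory Num.Theory.
Local Open Scope ring_scope.

(* ---------- Lie algebra g with basis x_1..x_n, via structure constants ----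
   [x_i, x_j] = \sum_k c i j k x_k *)
Section Lie.
Variables (F : fieldType) (n : nat) (c : 'I_n -> 'I_n -> 'I_n -> F).

Definition lie_structure_constants : Prop :=
  (forall i j k, c i j k = - c j i k) /\
  (forall i j k m,
     \sum_(l < n) (c i j l * c l k m + c j k l * c l i m + c k i l * c l j m) = 0).

(* phi : basis -> B extends to a Lie algebra map g -> (B, commutator) *)
Definition lie_rep (B : algType F) (phi : 'I_n -> B) : Prop :=
  forall i j, phi i * phi j - phi j * phi i = \sum_(k < n) c i j k *: phi k.

Definition alg_hom (A B : algType F) (f : A -> B) : Prop :=
  [/\ forall x y, f (x + y) = f x + f y,
      forall (a : F) x, f (a *: x) = a *: f x,
      forall x y, f (x * y) = f x * f y & f 1 = 1].

Definition is_enveloping (A : algType F) (iota : 'I_n -> A) : Prop :=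
  lie_rep iota /\
  forall (B : algType F) (phi : 'I_n -> B), lie_rep phi ->
    (exists f : A -> B, alg_hom f /\ forall i, f (iota i) = phi i) /\
    (forall f1 f2 : A -> B, alg_hom f1 -> alg_hom f2 ->
       (forall i, f1 (iota i) = f2 (iota i)) -> forall x, f1 x = f2 x).
End Lie.

(* ---------- Hausdorff series: coefficients of log(e^X e^Y) ----------------
   Words in X (= true) and Y (= false).  Z := e^X e^Y - 1 = sum over nonempty
   words X^p Y^q of X^p Y^q/(p! q!);  log(1+Z) = sum_{m>=1} (-1)^(m+1) Z^m/m. *)
Definition zcoef (u : seq bool) : rat :=
  if (0 < size u)%N && sorted (fun a b => b ==> a) u
  then (((count id u)`!)%:R * ((size u - count id u)`!)%:R)^-1 else 0.

Fixpoint pcoef (m : nat) (w : seq bool) : rat :=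
  match m with
  | 0 => (w == [::])%:R
  | m'.+1 => \sum_(1 <= i < (size w).+1) zcoef (take i w) * pcoef m' (drop i w)
  end.

(* coefficient of the word w in log(e^X e^Y); Z^m only has words of length
   >= m, so the truncation m <= size w is exact. H_P = the words of length P. *)
Definition hcoef (w : seq bool) : rat :=
  \sum_(1 <= m < (size w).+1) ((-1) ^+ m.+1 / m%:R) * pcoef m w.

Section Symm.
Variables (F : fieldType) (n : nat) (A : algType F) (iota : 'I_n -> A).

Definition mword (m : 'X_{1..n}) : seq 'I_n :=
  flatten [seq nseq (m i) i | i <- enum 'I_n].

Definition xi_mon (m : 'X_{1..n}) : A :=
  let t := in_tuple (mword m) in
  (((size (mword m))`!)%:R : F)^-1 *:
    \sum_(s : 'S_(size (mword m))) \prod_(j < size (mword m)) iota (tnth t (s j)).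

Definition xi (p : {mpoly F[n]}) : A := \sum_(m <- msupp p) p@_m *: xi_mon m.

Definition xi_inv (a : A) : {mpoly F[n]} :=
  epsilon (inhabits 0) (fun p => xi p = a).

Definition star (f g : {mpoly F[n]}) : {mpoly F[n]} := xi_inv (xi f * xi g).

(* cf I J = coefficient of d^I (x) d^J in Delta(d^mu).  The sum is over the
   pairs (I,J) for which d^I f and d^J g can be nonzero (deg I < msize f etc.);
   all omitted terms vanish. *)
Definition is_coproduct (mu : 'I_n) (cf : 'X_{1..n} -> 'X_{1..n} -> F) : Prop :=
  forall f g : {mpoly F[n]},
    mderiv mu (star f g) =
    \sum_(I : 'X_{1..n < msize f}) \sum_(J : 'X_{1..n < msize g})
       cf I J *: star (mderivm I f) (mderivm J g).

(* Variables k^1..k^n, q^1..q^n: indices lshift/rshift in 'I_(n+n).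
   K = sum k^a \hat x_a,  Q = sum q^a \hat x_a, in U(g) (x) F[k,q]. *)
Definition Kv : {mpoly A[n + n]} :=
  \sum_(a < n) 'X_(lshift n a) * mpolyC (n + n) (iota a).
Definition Qv : {mpoly A[n + n]} :=
  \sum_(a < n) 'X_(rshift n a) * mpolyC (n + n) (iota a).

Definition Heval (P : nat) : {mpoly A[n + n]} :=
  \sum_(w : P.-tuple bool)
     mpolyC (n + n) ((ratr (hcoef w) : F)%:A) *
     \prod_(j < P) (if tnth w j then Kv else Qv).

Definition is_D (D : nat -> 'I_n -> {mpoly F[n + n]}) : Prop :=
  forall P, (0 < P)%N ->
    Heval P = \sum_(mu < n) map_mpoly (in_alg A) (D P mu) * mpolyC (n + n) (iota mu).
End Symm.

Definition mjoin (n : nat) (I J : 'X_{1..n}) : 'X_{1..n + n} :=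
  [multinom (match split i with inl a => I a | inr b => J b end) | i < n + n].

(* coefficient of d^I (x) d^J in  sum_{P>=1} D^mu_P(d (x) 1, 1 (x) d) *)
Definition Dser (F : fieldType) (n : nat) (D : nat -> 'I_n -> {mpoly F[n + n]})
  (mu : 'I_n) (I J : 'X_{1..n}) : F :=
  if (0 < mdeg I + mdeg J)%N then (D (mdeg I + mdeg J)%N mu)@_(mjoin I J) else 0.

(* Main.v *)
(** The symmetrization map [xi] is injective (Poincare-Birkhoff-Witt): the Lie algebra
    acts on polynomials by the recursion that left multiplication obeys in the basis of
    ordered monomials, and [xi p] sends [1] to [p] plus terms of lower degree.

    Since [xi] maps powers of a linear form to powers of the corresponding element of
    [U(g)], also with formal coefficients, it maps [exp (k.x)] to [exp K] and
    [exp (D(k,q).x)] to [exp (\sum_P H_P(K,Q)) = exp K exp Q].  Hence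
    [exp (k.x) * exp (q.x) = exp (D(k,q).x)] for the star product, and [d/dx_mu]
    multiplies the right-hand side by [D^mu(k,q)], which on the left-hand side is the
    action of [D^mu(d (x) 1, 1 (x) d)].  As monomials are the coefficients of
    [exp (k.x)], this is the coproduct identity.  Uniqueness of the coproduct follows by
    evaluating on [x^I] and [x^J], by induction on [|I| + |J|].

    Formal exponentials are replaced by truncated ones in [{mpoly A[n + n]}], compared
    modulo polynomials of order greater than [N]. *)
Require Import Defs.
From HB Require Import structures.
From mathcomp Require Import all_boot all_order all_algebra all_fingroup.
From mathcomp Require Import mpoly ssrcomplements.
From mathcomp Require Import zify ring.
From mathcomp Require boolp.
From Stdlib Require Import FunctionalExtensionality ProofIrrelevance ClassicalEpsilon.
Set Implicit Arguments. Unset Strict Implicit. Unset Printing Implicit Defensive.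
Import Order.TTheory GRing.Theory Num.Theory.
Local Open Scope ring_scope.

(** * The algebra of endomorphisms of a polynomial ring *)
Section Endomorphisms.
Variables (F : fieldType) (n : nat).
Local Notation V := {mpoly F[n]}.

(** The universal property in [is_enveloping] only yields maps into algebras over [F], so the linear
    endomorphisms of the polynomial ring are made into one. *)
Record endo := Endo { endo_fun :> V -> V; endoP : linear endo_fun }.

HB.instance Definition _ (f : endo) :=
  GRing.isLinear.Build F V V *:%R (endo_fun f) (@endoP f).

Lemma endo_eq (f g : endo) : endo_fun f =1 endo_fun g -> f = g.
Proof.
case: f g => [f fP] [g gP] /= /functional_extensionality fg.
by subst g; rewrite (proof_irrelevance _ fP gP).
Qed.

HB.instance Definition _ := boolp.gen_eqMixin endo.
HB.instance Definition _ := boolp.gen_choiceMixin endo.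

Fact endo_zero_linear : linear (fun _ : V => 0 : V).
Proof. by move=> a x y; rewrite scaler0 addr0. Qed.
Fact endo_opp_linear (f : endo) : linear (fun x => - f x).
Proof. by move=> a x y; rewrite linearP scalerN opprD. Qed.
Fact endo_add_linear (f g : endo) : linear (fun x => f x + g x).
Proof. by move=> a x y; rewrite !linearP scalerDr addrACA. Qed.
Fact endo_scale_linear (a : F) (f : endo) : linear (fun x => a *: f x).
Proof. by move=> b x y; rewrite linearP scalerDr !scalerA mulrC. Qed.
Fact endo_one_linear : linear (fun x : V => x).
Proof. by []. Qed.
Fact endo_mul_linear (f g : endo) : linear (fun x => f (g x)).
Proof. by move=> b x y; rewrite !linearP. Qed.

Definition endo_zero := Endo endo_zero_linear.
Definition endo_opp f := Endo (endo_opp_linear f).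
Definition endo_add f g := Endo (endo_add_linear f g).
Definition endo_scale a f := Endo (endo_scale_linear a f).
Definition endo_one := Endo endo_one_linear.
Definition endo_mul f g := Endo (endo_mul_linear f g).

Fact endo_addA : associative endo_add.
Proof. by move=> f g h; apply: endo_eq => x /=; rewrite addrA. Qed.
Fact endo_addC : commutative endo_add.
Proof. by move=> f g; apply: endo_eq => x /=; rewrite addrC. Qed.
Fact endo_add0 : left_id endo_zero endo_add.
Proof. by move=> f; apply: endo_eq => x /=; rewrite add0r. Qed.
Fact endo_addN : left_inverse endo_zero endo_opp endo_add.
Proof. by move=> f; apply: endo_eq => x /=; rewrite addNr. Qed.

HB.instance Definition _ :=
  GRing.isZmodule.Build endo endo_addA endo_addC endo_add0 endo_addN.

Fact endo_mulA : associative endo_mul.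
Proof. by move=> f g h; apply: endo_eq. Qed.
Fact endo_mul1 : left_id endo_one endo_mul.
Proof. by move=> f; apply: endo_eq. Qed.
Fact endo_mulr1 : right_id endo_one endo_mul.
Proof. by move=> f; apply: endo_eq. Qed.
Fact endo_mulDl : left_distributive endo_mul +%R.
Proof. by move=> f g h; apply: endo_eq. Qed.
Fact endo_mulDr : right_distributive endo_mul +%R.
Proof. by move=> f g h; apply: endo_eq => x /=; rewrite linearD. Qed.
Fact endo_one_neq0 : endo_one != 0 :> endo.
Proof.
apply/eqP => /(congr1 (fun f : endo => f 1)) /= /eqP.
by rewrite oner_eq0.
Qed.

HB.instance Definition _ := GRing.Zmodule_isNzRing.Build endo
  endo_mulA endo_mul1 endo_mulr1 endo_mulDl endo_mulDr endo_one_neq0.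

Fact endo_scaleA (a b : F) (f : endo) :
  endo_scale a (endo_scale b f) = endo_scale (a * b) f.
Proof. by apply: endo_eq => x /=; rewrite scalerA. Qed.
Fact endo_scale1 : left_id 1 endo_scale.
Proof. by move=> f; apply: endo_eq => x /=; rewrite scale1r. Qed.
Fact endo_scaleDr : right_distributive endo_scale +%R.
Proof. by move=> a f g; apply: endo_eq => x /=; rewrite scalerDr. Qed.
Fact endo_scaleDl (f : endo) : {morph endo_scale^~ f : a b / a + b}.
Proof. by move=> a b; apply: endo_eq => x /=; rewrite scalerDl. Qed.

HB.instance Definition _ := GRing.Zmodule_isLmodule.Build F endo
  endo_scaleA endo_scale1 endo_scaleDr endo_scaleDl.

Fact endo_scaleAl (a : F) (f g : endo) : a *: (f * g) = (a *: f) * g.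
Proof. exact: endo_eq. Qed.
HB.instance Definition _ := GRing.Lmodule_isLalgebra.Build F endo endo_scaleAl.
Fact endo_scaleAr (a : F) (f g : endo) : a *: (f * g) = f * (a *: g).
Proof. by apply: endo_eq => x /=; rewrite linearZ. Qed.
HB.instance Definition _ := GRing.Lalgebra_isAlgebra.Build F endo endo_scaleAr.

Lemma endo_sumE (I : Type) (r : seq I) (P : pred I) (f : I -> endo) x :
  (\sum_(i <- r | P i) f i) x = \sum_(i <- r | P i) f i x.
Proof. by elim/big_rec2: _ => // i y z _ <-. Qed.

End Endomorphisms.

(** * Injectivity of the symmetrization map *)
Section LinearExtension.
Variables (F : fieldType) (n : nat) (V : lmodType F).
Implicit Types (f g : 'X_{1..n} -> V) (p q : {mpoly F[n]}).

(** The linear map prescribed on monomials; [xi] is the instance with values [xi_mon], up to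
    conversion. *)
Definition mext f p : V := \sum_(m <- msupp p) p@_m *: f m.

Lemma mextwE f p k : (msize p <= k)%N ->
  mext f p = \sum_(m : 'X_{1..n < k}) p@_m *: f m.
Proof.
move=> lt_pk; pose I : subFinType _ := 'X_{1..n < k}.
rewrite /mext (big_mksub I) //=; first last.
- by move=> x /msize_mdeg_lt /leq_trans; apply.
- by rewrite msupp_uniq.
by rewrite big_rmcond //= => i /memN_msupp_eq0->; rewrite scale0r.
Qed.

Fact mext_is_linear f : linear (mext f).
Proof.
move=> a p q; pose k := maxn (msize (a *: p + q)) (maxn (msize p) (msize q)).
rewrite !(@mextwE f _ k) ?leq_max ?leqnn ?orbT //.
rewrite scaler_sumr -big_split /=; apply: eq_bigr => m _.
by rewrite mcoeffD mcoeffZ scalerDl scalerA.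
Qed.

HB.instance Definition _ f :=
  GRing.isLinear.Build F {mpoly F[n]} V *:%R (mext f) (mext_is_linear f).

Lemma mextX f m : mext f 'X_[m] = f m.
Proof. by rewrite /mext msuppX big_seq1 mcoeffX eqxx scale1r. Qed.

Lemma eq_mext_size f g p k :
  (forall m, (mdeg m < k)%N -> f m = g m) -> (msize p <= k)%N ->
  mext f p = mext g p.
Proof.
move=> fg pk; rewrite /mext !big_seq; apply: eq_bigr => m /msize_mdeg_lt mp.
by rewrite fg // (leq_trans mp).
Qed.

Lemma linear_mext (f : {mpoly F[n]} -> V) : linear f ->
  forall p, f p = mext (fun m => f 'X_[m]) p.
Proof.
move=> lf p; pose h : {linear {mpoly F[n]} -> V} :=
  HB.pack f (GRing.isLinear.Build _ _ _ _ f lf).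
rewrite -[f]/(h : _ -> _) {1}[p]mpolyE linear_sum.
by apply: eq_bigr => m _; rewrite linearZ.
Qed.
End LinearExtension.

Section SizeLemmas.
Variables (F : fieldType) (n : nat).
Implicit Types p q : {mpoly F[n]}.

Lemma msizeD_leq p q k : (msize p <= k -> msize q <= k -> msize (p + q) <= k)%N.
Proof. by move=> pk qk; apply: leq_trans (msizeD_le _ _) _; rewrite geq_max pk. Qed.

Lemma msize_sum_leq (I : Type) (r : seq I) (P : pred I) (f : I -> {mpoly F[n]}) k :
  (forall i, P i -> msize (f i) <= k)%N -> (msize (\sum_(i <- r | P i) f i) <= k)%N.
Proof.
move=> fk; elim/big_rec: _ => [|i p Pi pk]; first by rewrite msize0.
by apply: msizeD_leq => //; apply: fk.
Qed.

Lemma msizeZ_leq (a : F) p k : (msize p <= k -> msize (a *: p) <= k)%N.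
Proof. exact: leq_trans (msizeZ_le _ _). Qed.

Lemma msizeXM_leq i p k : (msize p <= k -> msize ('X_i * p) <= k.+1)%N.
Proof.
move=> pk; rewrite [p]mpolyE mulr_sumr big_seq.
apply: msize_sum_leq => m /msize_mdeg_lt mp.
rewrite -scalerAr; apply: msizeZ_leq; rewrite -mpolyXD msizeX mdegD mdeg1.
by rewrite add1n ltnS (leq_trans mp).
Qed.

Lemma mext_msize (f : 'X_{1..n} -> {mpoly F[n]}) p k :
  (forall m, (mdeg m < msize p)%N -> msize (f m) <= k)%N ->
  (msize (mext f p) <= k)%N.
Proof.
move=> fk; rewrite /mext big_seq; apply: msize_sum_leq => m mp.
by apply/msizeZ_leq/fk/msize_mdeg_lt.
Qed.
End SizeLemmas.

(** * The action of the Lie algebra by left multiplication on ordered monomials *)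

Section Action.
Variables (F : fieldType) (n : nat) (c : 'I_n -> 'I_n -> 'I_n -> F).
Local Notation V := {mpoly F[n]}.
Implicit Types (i j k : 'I_n) (m : 'X_{1..n}).

Definition least_var (m : 'X_{1..n}) : pred 'I_n :=
  fun j => (m j != 0%N) && [forall k : 'I_n, (m k != 0%N) ==> (j <= k)%N].

(* Left multiplication by the i-th generator in the basis of ordered monomials,
   the first argument being an upper bound on the degree of the monomial. *)
Fixpoint lmul_mon (d : nat) (i : 'I_n) (m : 'X_{1..n}) : V :=
  if d is d'.+1 then
    if [pick j | least_var m j & (j < i)%N] is Some j then
      let m' := (m - U_(j))%MM in
      'X_i * 'X_[m] + mext (lmul_mon d' j) (lmul_mon d' i m' - 'X_i * 'X_[m'])
        + \sum_(k < n) c i j k *: lmul_mon d' k m'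
    else 'X_i * 'X_[m]
  else 'X_i * 'X_[m].

Definition lmul i : V -> V := mext (fun m => lmul_mon (mdeg m) i m).
HB.instance Definition _ i := GRing.Linear.on (lmul i).

Lemma least_var_ex m : m != 0%MM -> exists j, least_var m j.
Proof.
move=> m0; have /existsP[j0 mj0] : [exists j, m j != 0%N].
  apply: contraNT m0; rewrite negb_exists => /forallP m0.
  by apply/eqP/mnmP => i; rewrite mnm0E; apply/eqP; rewrite -[_ == _]negbK.
case: (@arg_minnP _ j0 (fun j => m j != 0%N) (fun j => j : nat) mj0) => j mj jmin.
by exists j; rewrite /least_var mj; apply/forallP => k; apply/implyP/jmin.
Qed.

Lemma least_var_uniq m j k : least_var m j -> least_var m k -> j = k.
Proof.
case/andP=> mj /forallP jP /andP[mk /forallP kP]; apply/val_inj/eqP => /=.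
by rewrite eqn_leq (implyP (jP k)) ?(implyP (kP j)).
Qed.

Lemma mdeg_least_var m j : least_var m j -> mdeg m = (mdeg (m - U_(j))%MM).+1.
Proof.
case/andP=> mj _; have /submK {1}<- : (U_(j) <= m)%MM by rewrite lep1mP.
by rewrite mdegD mdeg1 addn1.
Qed.

Lemma lmul_monS d i m : lmul_mon d.+1 i m =
  if [pick j | least_var m j & (j < i)%N] is Some j then
    let m' := (m - U_(j))%MM in
    'X_i * 'X_[m] + mext (lmul_mon d j) (lmul_mon d i m' - 'X_i * 'X_[m'])
      + \sum_(k < n) c i j k *: lmul_mon d k m'
  else 'X_i * 'X_[m].
Proof. by []. Qed.

(** Both claims go by one induction: by the second claim the correction fed to [lmul_mon d j] has
    degree at most that of [m'], and only then does the first claim apply to its monomials. *)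
Lemma lmul_mon_stable d i m : (mdeg m <= d)%N ->
  lmul_mon d.+1 i m = lmul_mon d i m /\
  (msize (lmul_mon d i m - 'X_i * 'X_[m]) <= (mdeg m).+1)%N.
Proof.
elim: d i m => [|d IH] i m md.
  have m0 : m = 0%MM by apply/eqP; rewrite -mdeg_eq0 -leqn0.
  rewrite /=; case: pickP => [j|_]; last by rewrite subrr msize0.
  by rewrite /least_var m0 mnm0E.
rewrite (lmul_monS d.+1 i m) (lmul_monS d i m).
case: pickP => [j /andP[mj ji]|_]; last by rewrite subrr msize0.
have mE := mdeg_least_var mj; cbv zeta.
set m' := (m - U_(j))%MM in mE *.
have m'd : (mdeg m' <= d)%N by rewrite -ltnS -mE.
rewrite (IH i m' m'd).1; split.
  congr (_ + _ + _); last by apply: eq_bigr => k _; rewrite (IH k m' m'd).1.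
  apply: (@eq_mext_size _ _ _ _ _ _ d.+1) => [m2 m2d|]; first by rewrite (IH j m2 _).1.
  exact: leq_trans (IH i m' m'd).2 _.
have sz k m2 : (mdeg m2 <= mdeg m')%N -> (msize (lmul_mon d k m2) <= (mdeg m).+1)%N.
  move=> m2m'; rewrite -[lmul_mon _ _ _](subrK ('X_k * 'X_[m2])).
  have m2d := leq_trans m2m' m'd.
  apply: msizeD_leq; first by apply: leq_trans (IH k m2 m2d).2 _; rewrite mE ltnS leqW.
  by apply: msizeXM_leq; rewrite msizeX mE ltnS.
rewrite [X in msize X](_ : _ = mext (lmul_mon d j) (lmul_mon d i m' - 'X_i * 'X_[m'])
   + \sum_(k < n) c i j k *: lmul_mon d k m'); last by rewrite [LHS]addrC -addrA addKr.
apply: msizeD_leq; last by apply: msize_sum_leq => k _; apply/msizeZ_leq/sz.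
apply: mext_msize => m2 /leq_trans /(_ (IH i m' m'd).2); rewrite ltnS; exact: sz.
Qed.

Lemma lmul_monE d i m : (mdeg m <= d)%N -> lmul_mon d i m = lmul i 'X_[m].
Proof.
rewrite /lmul mextX => /subnK <-; elim: (d - _)%N => // k IH.
by rewrite addSn (lmul_mon_stable _ _).1 // leq_addl.
Qed.

Lemma lmul_lead i (p : V) (k : nat) : (msize p <= k -> msize (lmul i p - 'X_i * p) <= k)%N.
Proof.
move=> pk; rewrite [p]mpolyE linear_sum mulr_sumr -sumrB big_seq.
apply: msize_sum_leq => m mp; rewrite linearZ /= -scalerAr -scalerBr.
apply: msizeZ_leq; rewrite -/(lmul i _) -(@lmul_monE (mdeg m)) //.
apply: leq_trans (lmul_mon_stable _ _).2 _ => //.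
exact: leq_trans (msize_mdeg_lt mp) pk.
Qed.

Lemma lmul_le i m : (forall k : 'I_n, m k != 0%N -> i <= k)%N ->
  lmul i 'X_[m] = 'X_i * 'X_[m].
Proof.
move=> im; rewrite -(@lmul_monE (mdeg m).+1) //=.
case: pickP => // j /andP[/andP[mj _]]; rewrite ltnNge.
by rewrite im.
Qed.

(** The defining recursion read as a commutation rule. Since [j] is least in [x_j m], the recursion
    replaces [x_i x_j m] by [x_j (x_i m) + [x_i, x_j] m]; on the leading part of [x_i m], the
    operator of [j] is plain multiplication, again by minimality of [j]. *)
Lemma lmul_swap i j m : (j < i)%N -> (forall k : 'I_n, m k != 0%N -> j <= k)%N ->
  lmul i (lmul j 'X_[m]) =
  lmul j (lmul i 'X_[m]) + \sum_(k < n) c i j k *: lmul k 'X_[m].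
Proof.
move=> ji jm; rewrite (lmul_le jm) -mpolyXD.
have jP : least_var (U_(j) + m)%MM j.
  rewrite /least_var mnmDE mnm1E eqxx /=; apply/forallP => k.
  apply/implyP; rewrite mnmDE mnm1E; case: (j =P k) => [->//|_]; exact: jm.
rewrite -(@lmul_monE (mdeg m).+1) ?mdegD ?mdeg1 //=.
case: pickP => [j' /andP[j'P _]|/(_ j)]; last by rewrite jP ji.
rewrite {j' j'P}(least_var_uniq j'P jP) addmC addmK.
congr (_ + _); last by apply: eq_bigr => k _; rewrite lmul_monE.
rewrite (lmul_monE _ (leqnn _)).
rewrite (@eq_mext_size _ _ _ _ (fun m => lmul_mon (mdeg m) j m) _ (mdeg m).+1).
- have -> : mext (fun m2 => lmul_mon (mdeg m2) j m2) (lmul i 'X_[m] - 'X_i * 'X_[m])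
      = lmul j (lmul i 'X_[m]) - lmul j 'X_[U_(i) + m].
    by rewrite mpolyXD -linearB.
  rewrite (@lmul_le j).
    have -> : 'X_i * 'X_[m + U_(j)] = 'X_j * 'X_[U_(i) + m] :> V.
      by rewrite addmC !mpolyXD mulrCA.
    by rewrite addrC subrK.
  move=> k; rewrite mnmDE mnm1E; case: (i =P k) => [<- _|_]; [exact: ltnW|exact: jm].
- by move=> m2 m2m; rewrite !lmul_monE.
- by apply: lmul_lead; rewrite msizeX.
Qed.

Lemma lmul_rest i p (d : nat) : (msize p <= d)%N ->
  exists2 r, lmul i p = 'X_i * p + r & (msize r <= d)%N.
Proof.
by move=> /(lmul_lead i) pd; exists (lmul i p - 'X_i * p); rewrite // addrC subrK.
Qed.

Hypothesis charF0 : [pchar F] =i pred0.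
Hypothesis cP : lie_structure_constants c.

Definition lmul_endo i : endo F n :=
  Endo (mext_is_linear (fun m => lmul_mon (mdeg m) i m)).
Arguments lmul_endo : simpl never.
Local Notation L := lmul_endo.

Definition lbr i j : endo F n :=
  L i * L j - L j * L i - \sum_(k < n) c i j k *: L k.

Lemma lbrE i j p : lbr i j p =
  L i (L j p) - L j (L i p) - \sum_(k < n) c i j k *: L k p.
Proof. by rewrite /lbr /= endo_sumE. Qed.
Arguments lbr : simpl never.

Lemma endo_oppE (f : endo F n) p : (- f) p = - f p.
Proof. by []. Qed.

Lemma endoD (f : endo F n) p q : f (p + q) = f p + f q.
Proof. exact: linearD. Qed.

Lemma endo_lin_sum (I : Type) (r : seq I) (f : endo F n) (a : I -> F) (p : I -> V) :
  f (\sum_(x <- r) a x *: p x) = \sum_(x <- r) a x *: f (p x).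
Proof. by rewrite linear_sum; apply: eq_bigr => x _; apply: linearZ. Qed.

Lemma lbrC i j : lbr i j = - lbr j i.
Proof.
rewrite /lbr opprD opprK opprB; congr (_ + _).
by rewrite -sumrN; apply: eq_bigr => k _; rewrite cP.1 scaleNr opprK.
Qed.

Lemma lbrii i : lbr i i = 0.
Proof.
(* Antisymmetry makes twice the defect zero, and 2 is invertible in characteristic 0. *)
have /(congr1 (fun x => x + lbr i i)) := lbrC i i.
rewrite addNr -mulr2n -scaler_nat => /eqP; rewrite scaler_eq0 => /orP[|/eqP//].
by rewrite ((pcharf0P F).1 charF0).
Qed.

(** For [j < i] this is [lmul_swap]; for [i < j] the index [i] is also below all variables of [m],
    and antisymmetry reduces to the first case. *)
Lemma lbr_least i j m : (forall k : 'I_n, m k != 0%N -> j <= k)%N ->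
  lbr i j 'X_[m] = 0.
Proof.
move=> jm; have [ij|ji|/val_inj->] := ltngtP i j; last by rewrite lbrii.
  rewrite lbrC endo_oppE lbrE -[L _ _]/(lmul _ (lmul _ _)) lmul_swap //.
    by rewrite addrAC addrK subrr oppr0.
  by move=> k /jm; apply/leq_trans/ltnW.
by rewrite lbrE -[L _ _]/(lmul _ (lmul _ _)) lmul_swap // addrAC addrK subrr.
Qed.

Lemma lbr_size i j (p : V) d : (forall m, (mdeg m < d)%N -> lbr i j 'X_[m] = 0) ->
  (msize p <= d)%N -> lbr i j p = 0.
Proof.
move=> H pd; rewrite [p]mpolyE endo_lin_sum big_seq big1 // => m mp.
by rewrite H ?scaler0 // (leq_trans (msize_mdeg_lt mp)).
Qed.

(** Heart of the Poincare-Birkhoff-Witt argument, by induction on the degree. After [lbr_least],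
    both [i] and [j] are above the least variable [k] of [m]. With [m = x_k N], the operator [L k]
    is moved to the left of [L i] and [L j], their commutator is then taken at [N], and the Jacobi
    identity cancels what remains. *)
Lemma lbr_mon0 d i j m : (mdeg m < d)%N -> lbr i j 'X_[m] = 0.
Proof.
elim: d i j m => // d IH i j m md.
have [->|m0] := eqVneq m 0%MM; first by apply: lbr_least => k; rewrite mnm0E.
have [k kP] := least_var_ex m0.
have km (l : 'I_n) : m l != 0%N -> (k <= l)%N.
  by case/andP: kP => _ /forallP/(_ l)/implyP.
case: (leqP i k) => [ik|ki].
  by rewrite lbrC endo_oppE lbr_least ?oppr0 // => l /km; apply: leq_trans.
case: (leqP j k) => [jk|kj].
  by rewrite lbr_least // => l /km; apply: leq_trans.
pose N := (m - U_(k))%MM; have mN := mdeg_least_var kP.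
have mE : m = (U_(k) + N)%MM.
  by rewrite addmC submK // lep1mP; case/andP: kP.
have kN (l : 'I_n) : N l != 0%N -> (k <= l)%N.
  by move=> Nl; apply: km; rewrite mE mnmDE addn_eq0 negb_and Nl orbT.
have Nd : (mdeg N < d)%N by rewrite -ltnS -mN.
have brE a b p : lbr a b p = 0 ->
    L a (L b p) = L b (L a p) + \sum_(l < n) c a b l *: L l p.
  by rewrite lbrE => /eqP; rewrite subr_eq0 subr_eq addrC => /eqP.
have LkN : L k 'X_[N] = 'X_[m] by rewrite mE mpolyXD; exact: lmul_le.
(* The leading part of [L b 'X_[N]] is covered by [lbr_least], since [k] is least in it,
   and the rest, of lower degree, by induction. *)
have brk (a b : 'I_n) : (k < b)%N -> lbr a k (L b 'X_[N]) = 0.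
  move=> kb; have := @lmul_rest b 'X_[N] d; rewrite msizeX => /(_ Nd)[r rE rd].
  rewrite -[L b _]/(lmul b _) rE endoD (@lbr_size _ _ r d) //; last by move=> m2; apply: IH.
  rewrite addr0 -mpolyXD lbr_least // => l; rewrite mnmDE mnm1E.
  by case: (b =P l) => [<- _|_]; [apply: ltnW|apply: kN].
have sumL a (f : 'I_n -> F) p :
    L a (\sum_(l < n) f l *: L l p) = \sum_(l < n) f l *: L a (L l p).
  exact: endo_lin_sum.
(* [L k] passes [L b] at [N] by induction and then [L a] by [brk]; inside the bracket terms, [L a]
   and [L l] are exchanged at [N] by induction. *)
have two (a b : 'I_n) : (k < a)%N -> (k < b)%N -> L a (L b 'X_[m]) =
    L k (L a (L b 'X_[N])) + \sum_(l < n) c a k l *: L l (L b 'X_[N])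
    + \sum_(l < n) c b k l *: L l (L a 'X_[N])
    + \sum_(l < n) c b k l *: \sum_(s < n) c a l s *: L s 'X_[N].
  move=> ka kb; rewrite -LkN (brE b k) ?IH // endoD (brE a k (L b 'X_[N])) ?brk // -[RHS]addrA.
  congr (_ + _).
  rewrite sumL -big_split; apply: eq_bigr => l _.
  by apply: etrans (scalerDr _ _ _); rewrite (brE a l) ?IH.
rewrite lbrE !two // -[in X in _ - X]LkN.
have -> : \sum_(l < n) c i j l *: L l (L k 'X_[N]) =
    L k (\sum_(l < n) c i j l *: L l 'X_[N])
    + \sum_(l < n) c i j l *: \sum_(s < n) c l k s *: L s 'X_[N].
  rewrite sumL -big_split; apply: eq_bigr => l _.
  by apply: etrans (scalerDr _ _ _); rewrite (brE l k) ?IH.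
rewrite (brE i j) ?IH // endoD.
(* The quadratic terms cancel in the final difference; the linear ones are the Jacobi identity for
   [i], [j], [k], paired with [L s] at [N]. *)
have J : \sum_(l < n) c j k l *: (\sum_(s < n) c i l s *: L s 'X_[N])
    - \sum_(l < n) c i k l *: (\sum_(s < n) c j l s *: L s 'X_[N])
    = \sum_(l < n) c i j l *: \sum_(s < n) c l k s *: L s 'X_[N].
  have ex (f : 'I_n -> F) (g : 'I_n -> 'I_n -> F) :
      \sum_(l < n) f l *: (\sum_(s < n) g l s *: L s 'X_[N])
      = \sum_(s < n) (\sum_(l < n) f l * g l s) *: L s 'X_[N].
    under eq_bigr do rewrite scaler_sumr.
    rewrite exchange_big; apply: eq_bigr => s _; rewrite scaler_suml.
    by apply: eq_bigr => l _; rewrite scalerA.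
  rewrite !ex -sumrB; apply: eq_bigr => s _; rewrite -scalerBl; congr (_ *: _).
  have /eqP := cP.2 i j k s; rewrite !big_split /= -addrA addr_eq0 => /eqP->.
  rewrite opprD -!sumrN; congr (_ + _); apply: eq_bigr => l _.
    by rewrite [c l i s]cP.1 mulrN opprK.
  by rewrite [c l j s]cP.1 [c k i l]cP.1 mulrNN.
rewrite -J opprD !addrA.
set X1 := \sum_(l < n) c i k l *: L l (L j _).
set X2 := \sum_(l < n) c j k l *: L l (L i _).
set X3 := L k (L j _).
set X4 := L k _; set X5 := \sum_(l < n) c j k l *: _; set X6 := \sum_(l < n) _.
by ring.
Qed.

Lemma lmul_lie_rep : lie_rep c L.
Proof.
move=> i j; apply/eqP; rewrite -subr_eq0; apply/eqP/endo_eq => p.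
by apply: (@lbr_size i j p (msize p)) => // m; apply: lbr_mon0.
Qed.

(** [L j] is multiplication by [x_j] up to terms of degree at most that of its argument, so each
    letter contributes one variable to the leading term. *)
Lemma lmul_word_lead (s : seq 'I_n) : exists2 r : V,
  (\prod_(j <- s) L j) 1 = \prod_(j <- s) 'X_j + r & (msize r <= size s)%N.
Proof.
have sz (t : seq 'I_n) : (msize (\prod_(j <- t) 'X_j : V) <= (size t).+1)%N.
  elim: t => [|j t IH]; first by rewrite big_nil msize1.
  by rewrite big_cons; apply: msizeXM_leq.
elim: s => [|j s [r rE rs]]; first by exists 0; rewrite ?msize0 // !big_nil addr0.
have psz : (msize (\prod_(j <- s) 'X_j + r) <= (size s).+1)%N.
  by apply: msizeD_leq => //; apply: leqW.
have [r' r'E r's] := @lmul_rest j _ _ psz.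
exists ('X_j * r + r'); last by apply: msizeD_leq => //; apply: msizeXM_leq.
rewrite !big_cons -[LHS]/(L j ((\prod_(j <- s) L j) 1)) rE.
by rewrite -[LHS]/(lmul j _) r'E mulrDr addrA.
Qed.

End Action.

(** * Words and symmetrized products *)

Section Words.
Variable n : nat.
Implicit Type m : 'X_{1..n}.

Lemma prod_mword (R : comPzSemiRingType) (f : 'I_n -> R) m :
  \prod_(x <- mword m) f x = \prod_(i < n) f i ^+ m i.
Proof.
rewrite big_flatten big_map big_enum; apply: eq_bigr => i _.
by rewrite big_nseq -Monoid.iteropE.
Qed.

Lemma size_mword m : size (mword m) = mdeg m.
Proof.
rewrite size_flatten /shape -map_comp sumnE big_map big_enum mdegE.
by apply: eq_bigr => i _; rewrite /= size_nseq.
Qed.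

Lemma count_mword m i : count_mem i (mword m) = m i.
Proof.
rewrite count_flatten sumnE big_map big_map big_enum (bigD1 i) //= count_nseq.
rewrite /= eqxx mul1n big1 ?addn0 // => j ji.
by rewrite count_nseq /= (negbTE ji).
Qed.

End Words.

Section Symmetrization.
Variables (F : fieldType) (n : nat) (A : algType F) (iota : 'I_n -> A).
Hypothesis charF0 : [pchar F] =i pred0.

Lemma natf_neq0_char0 k : (k != 0)%N -> k%:R != 0 :> F.
Proof. by rewrite ((pcharf0P F).1 charF0). Qed.

Lemma fact_neq0_char0 k : (k`!)%:R != 0 :> F.
Proof. by apply: natf_neq0_char0; rewrite -lt0n fact_gt0. Qed.

Fact xi_is_linear : linear (xi iota).
Proof. exact: (mext_is_linear (xi_mon iota)). Qed.
HB.instance Definition _ :=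
  GRing.isLinear.Build F {mpoly F[n]} A *:%R (xi iota) xi_is_linear.

Lemma xiX m : xi iota 'X_[m] = xi_mon iota m.
Proof. exact: mextX. Qed.

(** The average of [xi_mon], on an arbitrary word instead of a sorted one. *)
Definition symw (k : nat) (t : k.-tuple 'I_n) : A :=
  (k`!%:R : F)^-1 *: \sum_(s : 'S_k) \prod_(j < k) iota (tnth t (s j)).

Lemma symw_perm k (t u : k.-tuple 'I_n) : perm_eq t u -> symw t = symw u.
Proof.
case/tuple_permP => s ts; have {ts} tu : t = [tuple tnth u (s i) | i < k] by apply/val_inj.
rewrite /symw; congr (_ *: _); rewrite (reindex_inj (mulIg s^-1)%g) /=.
apply: eq_bigr => g _; apply: eq_bigr => j _.
by rewrite tu tnth_mktuple permM permKV.
Qed.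

(** [xi_mon] is stated with [in_tuple], whose length is the size of the word; this reconciles it
    with tuples of a given length [k]. *)
Lemma symw_in_tuple k (t : k.-tuple 'I_n) : symw t = symw (in_tuple t).
Proof.
by case: t => w wk; have e := eqP wk; subst k; congr symw; apply: val_inj.
Qed.

Lemma symw_mword k (t : k.-tuple 'I_n) m :
  perm_eq t (mword m) -> symw t = xi_mon iota m.
Proof.
move=> tm; have sz : size (mword m) == k by rewrite -(perm_size tm) size_tuple.
by rewrite (@symw_perm k t (Tuple sz)) // symw_in_tuple.
Qed.

Lemma xi_word k (t : k.-tuple 'I_n) :
  xi iota (\prod_(j < k) 'X_(tnth t j)) = symw t.
Proof.
pose m := [multinom count_mem i t | i < n].
have tm : perm_eq t (mword m).
  by apply/allP => i _; rewrite /= count_mword mnmE.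
rewrite (symw_mword tm) -xiX; congr (xi _ _).
rewrite -(big_tuple _ _ t xpredT (fun i => 'X_i)) (perm_big _ tm) /=.
by rewrite prod_mword -mpolyXE_id.
Qed.

End Symmetrization.

(** * Injectivity of [xi] from the action on 1 *)

Section Injectivity.
Variables (F : fieldType) (n : nat) (c : 'I_n -> 'I_n -> 'I_n -> F).
Variables (A : algType F) (iota : 'I_n -> A).
Hypothesis charF0 : [pchar F] =i pred0.
Hypothesis cP : lie_structure_constants c.
Hypothesis AP : is_enveloping c iota.

(** All words averaged in [xi_mon m] have the same commutative monomial [x^m], hence the same
    leading term when they act on 1. *)
Lemma xi_mon_act (f : A -> endo F n) : alg_hom f ->
  (forall i, f (iota i) = lmul_endo c i) ->
  forall m, (msize (f (xi_mon iota m) 1%R - 'X_[m])%R <= mdeg m)%N.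
Proof.
move=> [fD fZ fM f1] fiota m; set k := size (mword m).
have f0 : f 0 = 0 by rewrite -(scale0r 0) fZ scale0r.
have fsum (I : Type) (r : seq I) (P : pred I) (x : I -> A) :
    f (\sum_(i <- r | P i) x i) = \sum_(i <- r | P i) f (x i).
  by elim/big_rec2: _ => // i y z _ <-; rewrite fD.
have fprod (w : seq 'I_n) : f (\prod_(i <- w) iota i) = \prod_(i <- w) lmul_endo c i.
  by elim: w => [|i w IH]; rewrite ?big_nil ?f1 // !big_cons fM fiota IH.
pose t := in_tuple (mword m); pose pw (s : 'S_k) := [seq tnth t (s j) | j <- enum 'I_k].
have pwE s : perm_eq (pw s) (mword m).
  by apply/(@tuple_permP _ _ _ t); exists s; rewrite /pw.
have -> : f (xi_mon iota m) 1 - 'X_[m] = (k`!%:R : F)^-1 *: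
    \sum_s ((\prod_(j <- pw s) lmul_endo c j) 1 - 'X_[m]).
  rewrite sumrB sumr_const card_Sn scalerBr -scaler_nat scalerA.
  rewrite mulVf ?fact_neq0_char0 // scale1r /xi_mon fZ fsum /= endo_sumE.
  congr (_ *: _ - _); apply: eq_bigr => s _; rewrite -fprod.
  by rewrite /pw big_map enumT -/(index_enum _).
apply/msizeZ_leq/msize_sum_leq => s _.
have [r -> rs] := lmul_word_lead c (pw s).
rewrite (perm_big _ (pwE s)) /= prod_mword -mpolyXE_id addrC addKr.
by rewrite (leq_trans rs) // (perm_size (pwE s)) size_mword.
Qed.

(** If [d = p - q] is in the kernel, [xi d] acts on 1 by zero, yet the result is [d] plus terms of
    smaller degree; a nonzero [d] would have size smaller than itself. *)
Lemma xi_inj : injective (xi iota).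
Proof.
have [f [fh fiota]] := (AP.2 _ _ (lmul_lie_rep charF0 cP)).1.
have [fD fZ _ _] := fh.
have fL : linear (fun p => f (xi iota p) 1 - p).
  move=> a p q; rewrite linearP /= fD fZ /= scalerBr opprD.
  by rewrite addrACA.
move=> p q pq; apply/eqP; rewrite -subr_eq0; apply/eqP; set d := p - q.
have fd0 : f (xi iota d) 1 = 0.
  by rewrite linearB /= pq subrr -(scale0r 0) fZ /= scale0r.
apply/eqP; case: eqVneq => // d0.
suff : (msize d < msize d)%N by rewrite ltnn.
have lt0d : (0 < msize d)%N by rewrite lt0n msize_poly_eq0.
rewrite -[X in (_ < X)%N](prednK lt0d) ltnS -{1}[d]opprK -[- d]add0r -fd0 msizeN.
rewrite (linear_mext fL); apply: mext_msize => m; rewrite -{1}(prednK lt0d) ltnS.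
by apply: leq_trans; rewrite xiX; apply: xi_mon_act.
Qed.

(** The generators are the images under [xi] of the variables, which are independent. This is what
    determines [D] from its defining identity. *)
Lemma iota_free (a : 'I_n -> F) : \sum_(i < n) a i *: iota i = 0 -> forall i, a i = 0.
Proof.
move=> sum0 i; have xiU j : xi iota 'X_j = iota j.
  have := xi_word iota [tuple j].
  rewrite big_ord1 (tnth_nth j) /= => ->; rewrite /symw (big_pred1 1%g) => [|s].
    by rewrite big_ord1 (_ : 1`! = 1)%N // invr1 scale1r (tnth_nth j) ord1.
  by rewrite /= eq_sym; apply/esym/eqP/permP => x; rewrite perm1 ord1 [RHS]ord1.
have : xi iota (\sum_(i < n) a i *: 'X_i) = xi iota 0.
  rewrite linear_sum linear0 -[RHS]sum0; apply: eq_bigr => j _.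
  by rewrite linearZ /= xiU.
move/xi_inj/(congr1 (mcoeff U_(i))); rewrite mcoeff0 raddf_sum /= (bigD1 i) //=.
rewrite mcoeffZ mcoeffXU eqxx mulr1 big1 ?addr0 // => j ji.
by rewrite mcoeffZ mcoeffXU (negbTE ji) mulr0.
Qed.
End Injectivity.

(** * The exponential of the Hausdorff series *)
Section TruncatedExpLog.
Variable F : fieldType.
Hypothesis charF0 : [pchar F] =i pred0.

Definition exp_poly N : {poly F} := \sum_(0 <= m < N.+1) (m`!%:R)^-1 *: 'X^m.
Definition log_poly N : {poly F} :=
  \sum_(1 <= m < N.+1) ((-1) ^+ m.+1 / m%:R) *: 'X^m.

Lemma exp_poly_deriv N : (exp_poly N)^`() = exp_poly N - (N`!%:R)^-1 *: 'X^N.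
Proof.
rewrite /exp_poly raddf_sum /= big_nat_recl // [in RHS]big_nat_recr //= addrK.
rewrite derivZ derivXn mulr0n scaler0 add0r; apply: eq_bigr => i _.
rewrite derivZ derivXn -scaler_nat scalerA factS natrM; congr (_ *: _).
by rewrite invfM mulrAC mulVf ?mul1r // natf_neq0_char0.
Qed.

Lemma log_poly_deriv N : (1 + 'X) * (log_poly N)^`() = 1 - (- 'X) ^+ N.
Proof.
have -> : (log_poly N)^`() = \sum_(0 <= m < N) (- 'X) ^+ m.
  rewrite /log_poly raddf_sum /= big_add1 /=; apply: eq_bigr => i _.
  rewrite derivZ derivXn -scaler_nat scalerA divfK ?natf_neq0_char0 // !exprS.
  by rewrite mulrA mulrNN !mul1r [RHS]exprNn -[in RHS]signr_odd -signr_odd scaler_sign mulr_sign.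
rewrite big_mkord -[1 + 'X]opprK opprD -[- 1 - 'X]addrC mulNr -subrX1.
by rewrite opprB.
Qed.

Lemma log_polyM N : exists l, log_poly N = 'X * l.
Proof.
exists (\sum_(0 <= m < N) ((-1) ^+ m.+2 / m.+1%:R) *: 'X^m).
rewrite /log_poly big_add1 mulr_sumr /=; apply: eq_bigr => i _.
by rewrite -scalerAr -exprS.
Qed.

(* [g = exp (log (1 + X))] satisfies [(1 + X) g' = g] up to [X^N], which fixes its
   coefficients up to degree [N]. *)
Lemma exp_log_poly N :
  exists r : {poly F}, exp_poly N \Po log_poly N = 1 + 'X + r * 'X^(N.+1).
Proof.
set g := _ \Po _; have [l lE] := log_polyM N.
(* Chain rule: the two derivative identities have errors in [X^N] and in the [N]-th power of
   [log_poly]; the latter is divisible by [X^N] since [log_poly = X l]. *)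
have [s gE] : exists s, (1 + 'X) * g^`() = g + 'X^N * s.
  rewrite /g deriv_comp mulrCA log_poly_deriv exp_poly_deriv.
  rewrite comp_polyB comp_polyZ comp_Xn_poly -/g lE exprMn exprNn.
  exists (- (g * (-1) ^+ N) - (N`!%:R)^-1 *: (l ^+ N * (1 - (-1) ^+ N * 'X^N))).
  by rewrite -!mul_polyC; ring.
have grec j : (j < N)%N -> g`_j.+1 *+ j.+1 = g`_j - g`_j *+ j.
  move=> jN; have := congr1 (fun p : {poly F} => p`_j) gE.
  rewrite mulrDl mul1r !coefD coefXM coefXnM jN addr0 coef_deriv.
  case: j jN => [_|j jN] /=; first by rewrite mulr0n subr0 addr0.
  by rewrite coef_deriv => /(canRL (addrK _)).
have g0 : g`_0 = 1.
  rewrite -horner_coef0 horner_comp lE hornerM hornerX mul0r horner_coef0.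
  rewrite /exp_poly coef_sum big_nat_recl // coefZ coefXn fact0 invr1 mul1r.
  by rewrite big1 ?addr0 // => i _; rewrite coefZ coefXn mulr0.
(* At index 1 the recurrence reads [2 g_2 = g_1 - g_1]; above it, a zero coefficient forces the next
   one to vanish. *)
have g2 j : (j.+1 < N)%N -> g`_j.+2 = 0.
  elim: j => [|j IH] jN; apply/eqP; have /eqP := grec _ jN.
    by rewrite mulr1n subrr -mulr_natr mulf_eq0 (negbTE (natf_neq0_char0 _ _)) ?orbF.
  rewrite IH ?(ltnW jN) // mul0rn subrr -mulr_natr mulf_eq0.
  by rewrite (negbTE (natf_neq0_char0 _ _)) ?orbF.
exists (drop_poly N.+1 (g - (1 + 'X))).
apply/eqP; rewrite addrC -subr_eq; apply/eqP.
rewrite -[LHS](poly_take_drop N.+1) [X in X + _](_ : _ = 0) ?add0r //.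
apply/polyP => j; rewrite coef_take_poly coef0; case: ltnP => // jN.
rewrite coefB coefD coef1 coefX; case: j jN => [|[|j]] jN /=.
- by rewrite g0 addr0 subrr.
- by have := grec 0%N jN; rewrite g0 mulr1n mulr0n subr0 => ->; rewrite add0r subrr.
- by rewrite g2 // addr0 subr0.
Qed.

End TruncatedExpLog.

(** * Rational coefficients in a field of characteristic 0 *)

Section RationalsInChar0.
Variable F : fieldType.
Hypothesis charF0 : [pchar F] =i pred0.

Lemma intr_neq0_char0 (z : int) : z != 0 -> z%:~R != 0 :> F.
Proof.
case: z => k k0; first exact: natf_neq0_char0.
by rewrite NegzE mulrNz oppr_eq0; apply: natf_neq0_char0.
Qed.

Let nz_den (x : rat) : (denq x)%:~R != 0 :> F.
Proof. by rewrite intr_neq0_char0 ?denq_eq0. Qed.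

(** [ratr] is read off the reduced fraction; in characteristic 0 every representative gives the same
    quotient, so sums and products can be computed on unreduced ones. *)
Lemma ratr_frac_char0 (a b : int) : b != 0 ->
  ratr (a%:~R / b%:~R : rat) = a%:~R / b%:~R :> F.
Proof.
move=> b0; set x : rat := _ / _.
rewrite /ratr; apply/eqP; rewrite eqr_div ?intr_neq0_char0 ?nz_den //.
rewrite -!intrM; apply/eqP; congr (_%:~R); apply: (@intr_inj rat).
rewrite !intrM numqE mulrAC /x divfK ?intr_eq0 //.
Qed.

Lemma ratrE (x : rat) : exists a b : int, b != 0 /\ x = a%:~R / b%:~R.
Proof. by exists (numq x), (denq x); rewrite denq_eq0 divq_num_den. Qed.

Lemma ratr_zmod_char0 : zmod_morphism (@ratr F).
Proof.
move=> x y; have [a [b [b0 ->]]] := ratrE x; have [a' [b' [b'0 ->]]] := ratrE y.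
rewrite -mulNr addf_div ?intr_eq0 // -intrN -!intrM -intrD.
rewrite !ratr_frac_char0 ?mulf_neq0 // -mulNr addf_div ?intr_neq0_char0 //.
by rewrite -intrN -!intrM -intrD.
Qed.

Lemma ratr_monoid_char0 : monoid_morphism (@ratr F).
Proof.
split=> [|x y]; first by rewrite /ratr divr1.
have [a [b [b0 ->]]] := ratrE x; have [a' [b' [b'0 ->]]] := ratrE y.
rewrite mulf_div -!intrM !ratr_frac_char0 ?mulf_neq0 //.
by rewrite mulf_div -!intrM.
Qed.

(** The characteristic hypothesis is an argument so that a ring morphism structure can be attached
    to the map. *)
Definition ratr_char0 & [pchar F] =i pred0 := fun x : rat => ratr x : F.
HB.instance Definition _ :=
  GRing.isZmodMorphism.Build rat F (ratr_char0 charF0) ratr_zmod_char0.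
HB.instance Definition _ :=
  GRing.isMonoidMorphism.Build rat F (ratr_char0 charF0) ratr_monoid_char0.
End RationalsInChar0.

(** * Polynomials modulo terms of high order *)

Section LowOrder.
Variables (r : nat) (R : nzRingType).
Implicit Types p q : {mpoly R[r]}.

Definition low N p := forall m, (mdeg m < N)%N -> p@_m = 0.
Definition eqlow N p q := low N (p - q).

Lemma low0 N : low N 0.
Proof. by move=> m _; rewrite mcoeff0. Qed.

Lemma lowD N p q : low N p -> low N q -> low N (p + q).
Proof. by move=> pN qN m mN; rewrite mcoeffD pN ?qN ?addr0. Qed.

Lemma lowN N p : low N p -> low N (- p).
Proof. by move=> pN m mN; rewrite mcoeffN pN ?oppr0. Qed.

Lemma low_leq M N p : (M <= N)%N -> low N p -> low M p.
Proof. by move=> MN pN m mM; apply/pN/(leq_trans mM). Qed.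

Lemma lowM M N p q : low M p -> low N q -> low (M + N) (p * q).
Proof.
move=> pM qN m mMN; rewrite mcoeffM big1 // => -[k1 k2] /= /eqP mE.
have [k1M|Mk1] := ltnP (mdeg k1) M; first by rewrite pM ?mul0r.
rewrite qN ?mulr0 //; have := congr1 mdeg mE; rewrite mdegD; lia.
Qed.

Lemma lowMl N p q : low N q -> low N (p * q).
Proof. by move=> qN; rewrite -[N]add0n; apply: lowM. Qed.

Lemma lowMr N p q : low N p -> low N (p * q).
Proof. by move=> qN; rewrite -[N]addn0; apply: lowM. Qed.

Lemma low_sum N (I : Type) (s : seq I) (P : pred I) (f : I -> {mpoly R[r]}) :
  (forall i, P i -> low N (f i)) -> low N (\sum_(i <- s | P i) f i).
Proof.
by move=> fN; elim/big_rec: _ => [|i p Pi pN]; [apply: low0|apply: lowD; rewrite ?fN //; apply: fN].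
Qed.

Lemma lowX N p : low 1 p -> low N (p ^+ N).
Proof. by move=> p1; elim: N => // N IH; rewrite exprS -add1n; apply: lowM. Qed.

Lemma eqlow_refl N p : eqlow N p p.
Proof. by rewrite /eqlow subrr; apply: low0. Qed.

Lemma eqlow_sym N p q : eqlow N p q -> eqlow N q p.
Proof. by move=> pq; rewrite /eqlow -opprB; apply: lowN. Qed.

Lemma eqlow_trans N q p s : eqlow N p q -> eqlow N q s -> eqlow N p s.
Proof. by move=> pq qs; rewrite /eqlow -(subrK q p) -addrA; apply: lowD. Qed.

Lemma eqlowD N p p' q q' : eqlow N p p' -> eqlow N q q' -> eqlow N (p + q) (p' + q').
Proof. by move=> pp' qq'; rewrite /eqlow opprD addrACA; apply: lowD. Qed.

Lemma eqlowM N p p' q q' : eqlow N p p' -> eqlow N q q' -> eqlow N (p * q) (p' * q').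
Proof.
move=> pp' qq'; rewrite /eqlow -(subrK (p' * q) (p * q)) -mulrBl -addrA -mulrBr.
by apply: lowD; [apply: lowMr|apply: lowMl].
Qed.

Lemma eqlow_sum N (I : Type) (s : seq I) (P : pred I) (f g : I -> {mpoly R[r]}) :
  (forall i, P i -> eqlow N (f i) (g i)) ->
  eqlow N (\sum_(i <- s | P i) f i) (\sum_(i <- s | P i) g i).
Proof. by move=> fg; rewrite /eqlow -sumrB; apply: low_sum. Qed.

Lemma eqlowX N p q k : eqlow N p q -> eqlow N (p ^+ k) (q ^+ k).
Proof.
move=> pq; elim: k => [|k IH]; first exact: eqlow_refl.
by rewrite !exprS; apply: eqlowM.
Qed.

Lemma eqlow_coeff N p q m : eqlow N p q -> (mdeg m < N)%N -> p@_m = q@_m.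
Proof. by move=> pq /pq /eqP; rewrite mcoeffB subr_eq0 => /eqP. Qed.

(** Cauchy product of truncated series: the discarded products, with [i + j > N], have order above
    [N]. *)
Lemma eqlow_mul_sum N (x y : nat -> {mpoly R[r]}) :
  (forall i, low i (x i)) -> (forall i, low i (y i)) ->
  eqlow N.+1 ((\sum_(0 <= i < N.+1) x i) * (\sum_(0 <= j < N.+1) y j))
    (\sum_(0 <= P < N.+1) \sum_(0 <= i < P.+1) x i * y (P - i)%N).
Proof.
move=> xl yl.
(* The triangle [i <= P <= N] is summed by [i] first, with [j = P - i]. *)
have -> : \sum_(0 <= P < N.+1) \sum_(0 <= i < P.+1) x i * y (P - i)%N =
          \sum_(0 <= i < N.+1) \sum_(0 <= j < N.+1 - i) x i * y j.
  under eq_big_nat => P /andP[_ PN] do rewrite (big_nat_widen _ _ N.+1) //.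
  rewrite (exchange_big_dep_nat xpredT) //=; apply: eq_big_nat => i /andP[_ iN].
  rewrite -(@big_nat_widenl _ _ _ i 0 N.+1 xpredT (fun P => x i * y (P - i)%N)) //.
  by rewrite -{1}[i]add0n big_addn; apply: eq_bigr => j _; rewrite addnK.
rewrite mulr_suml; apply: eqlow_sum => i _.
rewrite mulr_sumr (@big_cat_nat _ _ _ (N.+1 - i)) ?leq_subr //=.
rewrite /eqlow addrAC subrr add0r big_nat; apply: low_sum => j /andP[ij _].
by apply: (@low_leq _ (i + j)%N); [lia|apply: lowM].
Qed.

End LowOrder.

(** * Sums over words *)

Section SumOverWords.
Variables (T : finType) (V : nmodType).
Implicit Type f : seq T -> V.

Lemma sum_tuple0 f : \sum_(w : 0.-tuple T) f w = f [::].
Proof. by rewrite (big_pred1 [tuple]) // => w; apply/esym/eqP; apply: tuple0. Qed.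

Lemma sum_tupleS k f :
  \sum_(w : k.+1.-tuple T) f w = \sum_(b : T) \sum_(w : k.-tuple T) f (b :: w).
Proof.
rewrite pair_bigA /= (reindex (fun p : T * k.-tuple T => cons_tuple p.1 p.2)) //=.
exists (fun w : k.+1.-tuple T => (thead w, behead_tuple w)) => [[b w] _|w _].
  by congr pair; apply: val_inj.
by rewrite [RHS]tuple_eta; apply: val_inj.
Qed.

Lemma sum_tuple_cat i j (G : seq T -> seq T -> V) :
  \sum_(w : (i + j).-tuple T) G (take i w) (drop i w) =
  \sum_(u : i.-tuple T) \sum_(v : j.-tuple T) G u v.
Proof.
elim: i G => [|i IH] G.
  rewrite (sum_tuple0 (fun u => \sum_(v : j.-tuple T) G u v)).
  by apply: eq_bigr => w _; rewrite take0 drop0.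
rewrite (sum_tupleS _ (fun w => G (take i.+1 w) (drop i.+1 w))).
rewrite (sum_tupleS _ (fun u => \sum_(v : j.-tuple T) G u v)).
by apply: eq_bigr => b _; apply: (IH (fun u v => G (b :: u) v)).
Qed.
End SumOverWords.

Section SortedWords.
Variable V : nmodType.
Implicit Type f : seq bool -> V.
Let trues_first (a b : bool) := b ==> a.

Lemma sum_sorted_false k f :
  \sum_(w : k.-tuple bool | sorted trues_first (false :: w)) f w = f (nseq k false).
Proof.
rewrite big_mkcond; elim: k f => [|k IH] f.
  by rewrite (sum_tuple0 (fun w => if sorted trues_first (false :: w) then f w else 0)).
rewrite (sum_tupleS _ (fun w => if sorted trues_first (false :: w) then f w else 0)).
by rewrite big_bool /= big1 ?add0r //; apply: (IH (fun w => f (false :: w))).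
Qed.

(** No X may follow a Y in this order, so the sorted words are [X^a Y^(k-a)]; the nonempty ones
    carry the nonzero coefficients of [e^X e^Y - 1]. *)
Lemma sum_sorted_words k f :
  \sum_(w : k.-tuple bool | sorted trues_first w) f w =
  \sum_(0 <= a < k.+1) f (nseq a true ++ nseq (k - a) false).
Proof.
rewrite big_mkcond; elim: k f => [|k IH] f.
  by rewrite (sum_tuple0 (fun w => if sorted trues_first w then f w else 0)) big_nat1.
rewrite (sum_tupleS _ (fun w => if sorted trues_first w then f w else 0)).
rewrite big_bool big_nat_recl // [LHS]addrC; congr (_ + _).
  by rewrite -big_mkcond; apply: (sum_sorted_false k (fun w => f (false :: w))).
rewrite -(IH (fun w => f (true :: w))); apply: eq_bigr => w _.
by case: (tval w) => [|[] w'].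
Qed.
End SortedWords.

(** * Evaluation of noncommutative series at two elements *)

Section EvalWords.
Variables (F : fieldType) (A : algType F) (r : nat).
Local Notation R := {mpoly A[r]}.

Definition scal (a : F) : R := mpolyC r (a%:A).
HB.instance Definition _ :=
  GRing.RMorphism.copy scal (@mpolyC r A \o GRing.in_alg A).

Lemma coef_scalM a (p : R) m : (scal a * p)@_m = a *: p@_m.
Proof. by rewrite mcoeffCM -scalerAl mul1r. Qed.

(** Scalars are central although [A] is not commutative: the coefficients of a product of words can
    be gathered in front. *)
Lemma scal_comm a (p : R) : GRing.comm p (scal a).
Proof.
elim/mpolyind: p => [|c m p _ _ IH]; first exact: commr_sym (commr0 _).
apply: commr_sym; apply: commrD (commr_sym IH).
rewrite -mul_mpolyC; apply: commrM (commr_mpolyX _ _).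
by rewrite /GRing.comm /scal -!rmorphM /= -scalerAl -scalerAr mul1r mulr1.
Qed.

Variables (K Q : R).
Hypothesis (K1 : low 1 K) (Q1 : low 1 Q).

Definition eval_word (w : seq bool) : R := \prod_(b <- w) (if b then K else Q).
Definition eval_words (a : seq bool -> F) P : R :=
  \sum_(w : P.-tuple bool) scal (a w) * eval_word w.

Lemma low_ev w : low (size w) (eval_word w).
Proof.
elim: w => [|b w IH]; first by move=> m.
by rewrite /eval_word big_cons -[size _]/(1 + size w)%N; apply: lowM => //; case: b.
Qed.

Lemma low_Ev a P : low P (eval_words a P).
Proof.
by apply: low_sum => w _; apply: lowMl; rewrite -{1}(size_tuple w); apply: low_ev.
Qed.

(** Coefficients of the product of two noncommutative power series. *)
Definition conv (a b : seq bool -> F) (w : seq bool) : F :=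
  \sum_(0 <= i < (size w).+1) a (take i w) * b (drop i w).

Lemma Ev_conv a b P :
  \sum_(0 <= i < P.+1) eval_words a i * eval_words b (P - i)%N = eval_words (conv a b) P.
Proof.
have split i j : eval_words a i * eval_words b j = \sum_(w : (i + j).-tuple bool)
    scal (a (take i w) * b (drop i w)) * eval_word w.
  transitivity (\sum_(w : (i + j).-tuple bool)
      scal (a (take i w) * b (drop i w)) *
      (eval_word (take i w) * eval_word (drop i w))); last first.
    by apply: eq_bigr => w _; rewrite /eval_word -big_cat cat_take_drop.
  rewrite (sum_tuple_cat i j (fun u v => scal (a u * b v) * (eval_word u * eval_word v))).
  rewrite mulr_suml; apply: eq_bigr => u _; rewrite mulr_sumr; apply: eq_bigr => v _.
  rewrite rmorphM !mulrA; congr (_ * _); rewrite -!mulrA; congr (_ * _).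
  exact: scal_comm.
transitivity (\sum_(0 <= i < P.+1) \sum_(w : P.-tuple bool)
    scal (a (take i w) * b (drop i w)) * eval_word w); last first.
  rewrite exchange_big; apply: eq_bigr => w _.
  by rewrite /conv size_tuple raddf_sum mulr_suml.
apply: eq_big_nat => i /andP[_ iP]; have := split i (P - i)%N.
by rewrite subnKC.
Qed.
End EvalWords.

(** * The logarithm of [exp K exp Q] and its exponential *)

Section BCH.
Variables (F : fieldType) (A : algType F) (r : nat).
Local Notation R := {mpoly A[r]}.
Hypothesis charF0 : [pchar F] =i pred0.
Local Notation scal := (@scal F A r).

Definition zcoefF w : F := ratr_char0 charF0 (zcoef w).
Definition pcoefF m w : F := ratr_char0 charF0 (pcoef m w).
Definition hcoefF w : F := ratr_char0 charF0 (hcoef w).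

Lemma zcoefFE w : zcoefF w =
  if (0 < size w)%N && sorted (fun a b => b ==> a) w
  then (((count id w)`!)%:R * ((size w - count id w)`!)%:R)^-1 else 0.
Proof.
rewrite /zcoefF /zcoef; case: ifP => _; last exact: rmorph0.
by rewrite fmorphV rmorphM !rmorph_nat.
Qed.

Lemma pcoefF0 w : pcoefF 0 w = (w == [::])%:R.
Proof. exact: rmorph_nat. Qed.

Lemma pcoefFS m w : pcoefF m.+1 w = conv zcoefF (pcoefF m) w.
Proof.
(* The cut with empty prefix, absent from [pcoef], contributes zero because [zcoef] vanishes on the
   empty word. *)
rewrite /conv big_ltn // take0 zcoefFE mul0r add0r /pcoefF /= rmorph_sum /=.
by apply: eq_bigr => i _; rewrite rmorphM.
Qed.

Lemma hcoefFE w : hcoefF w =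
  \sum_(1 <= m < (size w).+1) (-1) ^+ m.+1 / m%:R * pcoefF m w.
Proof.
rewrite /hcoefF /hcoef rmorph_sum; apply: eq_bigr => m _ /=.
by rewrite rmorphM fmorph_div rmorphXn rmorphN1 rmorph_nat.
Qed.

(** [e^X e^Y - 1] has no constant term, so its [m]-th power starts in degree [m]. *)
Lemma pcoefF_small m w : (size w < m)%N -> pcoefF m w = 0.
Proof.
elim: m w => // m IH w wm; rewrite pcoefFS /conv big_ltn // take0 zcoefFE mul0r add0r.
rewrite big_nat big1 // => i /andP[i1 iw]; rewrite IH ?mulr0 // size_drop; lia.
Qed.

Variables (K Q : R).
Hypothesis (K1 : low 1 K) (Q1 : low 1 Q).
Local Notation Ev := (eval_words K Q).

Definition expt N (x : R) : R := \sum_(0 <= a < N.+1) scal (a`!%:R)^-1 * x ^+ a.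

Lemma Ev0 a : Ev a 0 = scal (a [::]).
Proof.
rewrite /eval_words (sum_tuple0 (fun w => scal (a w) * eval_word K Q w)).
by rewrite /eval_word big_nil mulr1.
Qed.

(** Degree [P] part of [exp K exp Q]. The case [P = 0] is excluded: there [zcoef] is 0 while the
    product has the term 1. *)
Lemma Ev_zcoef P : (0 < P)%N -> Ev zcoefF P =
  \sum_(0 <= a < P.+1)
    (scal (a`!%:R)^-1 * K ^+ a) * (scal ((P - a)`!%:R)^-1 * Q ^+ (P - a)).
Proof.
move=> P0; rewrite /eval_words.
transitivity (\sum_(w : P.-tuple bool | sorted (fun a b => b ==> a) w)
   scal (((count id w)`!)%:R * ((size w - count id w)`!)%:R)^-1 * eval_word K Q w).
  rewrite [RHS]big_mkcond; apply: eq_bigr => w _.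
  by rewrite zcoefFE size_tuple P0 /=; case: ifP => // _; rewrite rmorph0 mul0r.
rewrite (sum_sorted_words P (fun w => scal (((count id w)`!)%:R *
  ((size w - count id w)`!)%:R)^-1 * eval_word K Q w)).
apply: eq_big_nat => a /andP[_ aP].
rewrite count_cat !count_nseq size_cat !size_nseq /= mul1n mul0n addn0.
rewrite subnKC // /eval_word big_cat !big_nseq -!Monoid.iteropE /=.
rewrite invfM rmorphM -!mulrA; congr (_ * _).
by rewrite !mulrA; congr (_ * _); apply/esym/scal_comm.
Qed.

Lemma low_expt_term N x : low 1 x -> low N (scal (N`!%:R)^-1 * x ^+ N).
Proof. by move=> x1; apply/lowMl/lowX. Qed.

Lemma scal1 : scal 1 = 1. Proof. exact: rmorph1. Qed.

Lemma expt_mul_zcoef N :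
  eqlow N.+1 (expt N K * expt N Q - 1) (\sum_(0 <= P < N.+1) Ev zcoefF P).
Proof.
have H := @eqlow_mul_sum _ _ N (fun a => scal (a`!%:R)^-1 * K ^+ a)
  (fun a => scal (a`!%:R)^-1 * Q ^+ a)
  (fun a => @low_expt_term a _ K1) (fun a => @low_expt_term a _ Q1).
apply: (eqlow_trans (eqlowD H (eqlow_refl (-1)))).
(* Subtracting 1 removes the degree 0 term of the product, in accordance with [zcoef] on the empty
   word. *)
rewrite big_ltn // [X in eqlow _ _ X]big_ltn // Ev0 zcoefFE rmorph0 add0r.
rewrite big_nat1 !expr0 fact0 invr1 scal1 !mulr1 addrC addKr.
have -> : \sum_(1 <= P < N.+1) \sum_(0 <= a < P.+1)
    (scal (a`!%:R)^-1 * K ^+ a) * (scal ((P - a)`!%:R)^-1 * Q ^+ (P - a)) =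
    \sum_(1 <= P < N.+1) Ev zcoefF P.
  by apply: eq_big_nat => P /andP[P0 _]; rewrite Ev_zcoef.
exact: eqlow_refl.
Qed.

Lemma expt_mul_pcoef N m :
  eqlow N.+1 ((expt N K * expt N Q - 1) ^+ m) (\sum_(0 <= P < N.+1) Ev (pcoefF m) P).
Proof.
elim: m => [|m IH].
  rewrite big_ltn // Ev0 pcoefF0 eqxx rmorph1 expr0 big_nat big1 ?addr0.
    exact: eqlow_refl.
  move=> P /andP[P0 _]; apply: big1 => w _; rewrite pcoefF0 -size_eq0 size_tuple.
  by rewrite eqn0Ngt P0 rmorph0 mul0r.
rewrite exprS; apply: (eqlow_trans (eqlowM (@expt_mul_zcoef N) IH)).
have lowE a i : low i (Ev a i) by apply: low_Ev.
apply: (eqlow_trans (@eqlow_mul_sum _ _ N _ _ (lowE zcoefF) (lowE (pcoefF m)))).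
apply: eqlow_sum => P _; rewrite Ev_conv.
rewrite [X in eqlow _ X _](_ : _ = Ev (pcoefF m.+1) P); first exact: eqlow_refl.
by apply: eq_bigr => w _; rewrite pcoefFS.
Qed.

Lemma log_expt_mul N :
  eqlow N.+1 (\sum_(1 <= m < N.+1) scal ((-1) ^+ m.+1 / m%:R) *
                (expt N K * expt N Q - 1) ^+ m)
    (\sum_(1 <= P < N.+1) Ev hcoefF P).
Proof.
suff <- : \sum_(1 <= m < N.+1) scal ((-1) ^+ m.+1 / m%:R) *
    (\sum_(0 <= P < N.+1) Ev (pcoefF m) P) = \sum_(1 <= P < N.+1) Ev hcoefF P.
  by apply: eqlow_sum => m _; apply: (eqlowM (eqlow_refl _)); apply: (@expt_mul_pcoef N).
under eq_bigr do rewrite mulr_sumr.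
rewrite exchange_big /= big_ltn //.
have -> : \sum_(1 <= m < N.+1) scal ((-1) ^+ m.+1 / m%:R) * Ev (pcoefF m) 0 = 0.
  rewrite big_nat big1 // => m /andP[m1 _].
  by rewrite Ev0 pcoefF_small // rmorph0 mulr0.
rewrite add0r.
apply: eq_big_nat => P /andP[P1 PN].
under eq_bigr do rewrite /eval_words mulr_sumr.
rewrite exchange_big; apply: eq_bigr => w _ /=.
under eq_bigr do rewrite mulrA -rmorphM.
rewrite -mulr_suml -rmorph_sum; congr (scal _ * _).
(* Powers [m > P] have no words of length [P], so the bound of [hcoef] agrees with the common bound
   [N]. *)
rewrite hcoefFE size_tuple (@big_cat_nat _ _ _ P.+1) //=.
rewrite [X in _ + X]big_nat [X in _ + X]big1 ?addr0 // => m /andP[Pm _].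
by rewrite pcoefF_small ?mulr0 // size_tuple.
Qed.

(** The one-variable identity [exp (log (1 + X)) = 1 + X] modulo [X^(N+1)] is transported by
    substituting [Z = exp K exp Q - 1]; as [Z] has no constant term, multiples of [Z^(N+1)] have
    order above [N]. *)
Theorem exp_hausdorff N :
  eqlow N.+1 (expt N (\sum_(1 <= P < N.+1) Ev hcoefF P)) (expt N K * expt N Q).
Proof.
set Z := expt N K * expt N Q - 1.
(* Evaluation at [Z] is a ring morphism because scalars commute with [Z]. *)
have [phi [phiX phiZ]] : exists phi : {rmorphism {poly F} -> R},
    phi 'X = Z /\ forall a p, phi (a *: p) = scal a * phi p.
  have Zc : commr_rmorph scal Z by move=> a; apply: scal_comm.
  exists (horner_morph Zc); split=> [|a p]; first exact: horner_morphX.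
  by rewrite -mul_polyC rmorphM; congr (_ * _); apply: horner_morphC.
have [s /(congr1 phi)] := exp_log_poly charF0 N.
have Zlow : low 1 Z.
  have := @expt_mul_zcoef N; rewrite -/Z => ZE.
  rewrite -(subrK (\sum_(0 <= P < N.+1) Ev zcoefF P) Z).
  apply: lowD; first exact: (@low_leq _ _ 1 N.+1).
  rewrite big_ltn // Ev0 zcoefFE rmorph0 add0r big_nat.
  by apply: low_sum => P /andP[P1 _]; apply: (@low_leq _ _ 1 P) => //; apply: low_Ev.
rewrite rmorphD rmorphM rmorphXn /= rmorphD rmorph1 phiX [1 + Z]addrC subrK => phiE.
apply: (@eqlow_trans _ _ _ (phi (exp_poly F N \Po log_poly F N))); last first.
  by rewrite phiE /eqlow addrAC subrr add0r; apply/lowMl/lowX.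
have -> : phi (exp_poly F N \Po log_poly F N) = expt N (phi (log_poly F N)).
  rewrite /exp_poly /expt; move: (log_poly F N) => l; rewrite !raddf_sum.
  apply: eq_bigr => i _ /=.
  by rewrite comp_polyZ comp_Xn_poly phiZ rmorphXn.
apply: eqlow_sym; apply: eqlow_sum => i _; apply: (eqlowM (eqlow_refl _)).
apply: eqlowX; apply: eqlow_trans (@log_expt_mul N).
rewrite /log_poly raddf_sum /= -/Z.
rewrite [X in eqlow _ X _](_ : _ = \sum_(1 <= m < N.+1) scal ((-1) ^+ m.+1 / m%:R) * Z ^+ m).
  exact: eqlow_refl.
by apply: eq_bigr => m _; rewrite phiZ rmorphXn phiX.
Qed.
End BCH.

(** * Generating functions *)
Section GeneratingFunctions.
Variables (F : fieldType) (n r : nat).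
Section Algebra.
Variables (B : algType F).
Implicit Types (u : 'I_n -> B) (d : 'I_n -> {mpoly F[r]}).

(** Covers [K], [Q] and [D(k,q).x], over [U(g)] for [u = iota] and over [S(g)] for [u] the
    variables, so one computation serves both sides of [xi]. *)
Definition lin_gen u d : {mpoly B[r]} :=
  \sum_(mu < n) map_mpoly (in_alg B) (d mu) * (u mu)%:MP.

Lemma coef_map_algMC (p : {mpoly F[r]}) (b : B) m :
  (map_mpoly (in_alg B) p * b%:MP)@_m = p@_m *: b.
Proof.
elim/mpolyind: p => [|c k p _ _ IH].
  by rewrite rmorph0 mul0r !mcoeff0 scale0r.
rewrite rmorphD /= mulrDl !mcoeffD scalerDl IH; congr (_ + _).
rewrite map_mpolyZ map_mpolyX /= -scalerAl mcoeffZ -commr_mpolyX mcoeffZ mcoeffCM.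
by rewrite !mcoeffX -scalerAl mul1r; case: (k == m); rewrite ?mulr1 // !mulr0 scaler0 scale0r.
Qed.

Lemma map_alg_comm (p : {mpoly F[r]}) (q : {mpoly B[r]}) :
  GRing.comm q (map_mpoly (in_alg B) p).
Proof.
elim/mpolyind: p => [|c m p _ _ IH]; first by rewrite rmorph0; apply: commr0.
rewrite rmorphD /=; apply: commrD IH; rewrite map_mpolyZ map_mpolyX -mul_mpolyC.
by apply: commrM (commr_mpolyX _ _); apply: scal_comm.
Qed.

Lemma lin_gen_expn u d j : lin_gen u d ^+ j =
  \sum_(t : j.-tuple 'I_n) map_mpoly (in_alg B) (\prod_(i <- t) d i) *
                            (\prod_(i <- t) u i)%:MP.
Proof.
elim: j => [|j IH].
  rewrite (sum_tuple0 (fun t => map_mpoly (in_alg B) (\prod_(i <- t) d i) *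
    (\prod_(i <- t) u i)%:MP)).
  by rewrite !big_nil rmorph1 mul1r mpolyC1 expr0.
rewrite (sum_tupleS _ (fun t => map_mpoly (in_alg B) (\prod_(i <- t) d i) *
  (\prod_(i <- t) u i)%:MP)).
rewrite exprS IH mulr_suml; apply: eq_bigr => i _.
rewrite mulr_sumr; apply: eq_bigr => t _.
rewrite !big_cons rmorphM mpolyCM -!mulrA; congr (_ * _).
by rewrite !mulrA; congr (_ * _); apply: map_alg_comm.
Qed.

Lemma coef_lin_gen u d m : (lin_gen u d)@_m = \sum_(mu < n) (d mu)@_m *: u mu.
Proof. by rewrite /lin_gen raddf_sum; apply: eq_bigr => i _; apply: coef_map_algMC. Qed.

Lemma coef_lin_gen_expn u d j m : (lin_gen u d ^+ j)@_m =
  \sum_(t : j.-tuple 'I_n) (\prod_(i <- t) d i)@_m *: \prod_(i <- t) u i.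
Proof.
rewrite lin_gen_expn raddf_sum; apply: eq_bigr => t _.
by rewrite /= coef_map_algMC.
Qed.

Lemma coef_expt N (x : {mpoly B[r]}) m :
  (expt N x)@_m = \sum_(0 <= a < N.+1) (a`!%:R)^-1 *: (x ^+ a)@_m.
Proof. by rewrite raddf_sum; apply: eq_bigr => a _; rewrite /= coef_scalM. Qed.
End Algebra.

Variables (A : algType F) (iota : 'I_n -> A).
Hypothesis charF0 : [pchar F] =i pred0.
Local Notation S := {mpoly F[n]}.
Local Notation X := (fun i : 'I_n => 'X_i : S).

(** The coefficient is a product of commuting polynomials, hence invariant under permuting the word;
    averaging over permutations leaves the sum of ordered products unchanged. *)
Lemma symw_sum (f : 'I_n -> {mpoly F[r]}) j m :
  \sum_(t : j.-tuple 'I_n) (\prod_(i <- t) f i)@_m *: symw iota t =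
  \sum_(t : j.-tuple 'I_n) (\prod_(i <- t) f i)@_m *: \prod_(i <- t) iota i.
Proof.
rewrite /symw.
under eq_bigr do rewrite scalerA mulrC -scalerA scaler_sumr.
rewrite -scaler_sumr exchange_big /=.
rewrite (eq_bigr (fun _ => \sum_(t : j.-tuple 'I_n)
   (\prod_(i <- t) f i)@_m *: \prod_(i <- t) iota i)) => [|s _].
  by rewrite sumr_const card_Sn -scaler_nat scalerA mulVf ?fact_neq0_char0 // scale1r.
rewrite [RHS](reindex (fun t : j.-tuple 'I_n => [tuple tnth t (s i) | i < j])).
  apply: eq_bigr => t _; rewrite !big_tuple; congr (_ *: _); last first.
    by apply: eq_bigr => i _; rewrite tnth_mktuple.
  congr (_@_m); rewrite (reindex_inj (@perm_inj _ s)) /=.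
  by apply: eq_bigr => i _; rewrite tnth_mktuple.
exists (fun t : j.-tuple 'I_n => [tuple tnth t (s^-1%g i) | i < j]) => t _;
  apply: eq_from_tnth => i; rewrite !tnth_mktuple ?permKV ?permK //.
Qed.

Lemma xi_lin_gen d j m :
  xi iota ((lin_gen X d ^+ j)@_m) = (lin_gen iota d ^+ j)@_m.
Proof.
rewrite !coef_lin_gen_expn -symw_sum linear_sum; apply: eq_bigr => t _.
by rewrite linearZ /= -xi_word [in X in xi _ X]big_tuple.
Qed.

Lemma xi_expt d N m :
  xi iota ((expt N (lin_gen X d))@_m) = (expt N (lin_gen iota d))@_m.
Proof.
rewrite !coef_expt linear_sum; apply: eq_bigr => a _.
by rewrite linearZ /= xi_lin_gen.
Qed.

End GeneratingFunctions.

(** * Multinomial coefficients of powers of a linear form *)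

Section MultinomialPowers.
Variable r : nat.
Implicit Types m : 'X_{1..r}.

Definition mfact m : nat := \prod_(i < r) (m i)`!.

Lemma mfact_sub1 m i : m i != 0%N -> mfact m = (m i * mfact (m - U_(i)))%N.
Proof.
move=> mi; rewrite /mfact (bigD1 i) //= [in RHS](bigD1 i) //= mulnA.
rewrite mnmBE mnm1E eqxx subn1; congr (_ * _)%N.
  by case: (m i) mi => // k _; rewrite factS.
by apply: eq_bigr => j ji; rewrite mnmBE mnm1E eq_sym (negbTE ji) subn0.
Qed.

Lemma coef_XM (R : nzRingType) i (p : {mpoly R[r]}) m :
  ('X_i * p)@_m = if m i != 0%N then p@_(m - U_(i))%MM else 0.
Proof.
rewrite -commr_mpolyX; case: ifPn => [mi|/negPn/eqP mi].
  have {1}-> : m = (U_(i) + (m - U_(i)))%MM by rewrite addmC submK // lep1mP.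
  exact: mcoeffMX.
rewrite mcoeffM big1 // => -[k1 k2] /= /eqP/mnmP/(_ i); rewrite mi mnmDE => k0.
rewrite mcoeffX; case: eqP => [k2E|_]; last by rewrite mulr0.
by move: k0; rewrite -k2E mnm1E eqxx addn1.
Qed.

(** Multinomial theorem, multiplied by [m!] so that no division occurs. *)
Lemma coef_linear_expn (R : comNzRingType) (v : 'I_r -> R) a m :
  (mfact m)%:R * ((\sum_(i < r) 'X_i * (v i)%:MP) ^+ a)@_m =
  if mdeg m == a then a`!%:R * \prod_(i < r) v i ^+ m i else 0.
Proof.
elim: a m => [|a IH] m.
  rewrite expr0 mcoeff1 mdeg_eq0; case: eqP => [->|_]; last by rewrite mulr0.
  rewrite /mfact !big1 ?mulr1 // => i _; by rewrite mnm0E.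
rewrite exprS mulr_suml raddf_sum mulr_sumr.
(* Splitting off one factor [X_i] gives [m_i] times a common expression, and the [m_i] add up to
   [a + 1]. *)
transitivity (\sum_(i < r) (if mdeg m == a.+1 then
    (m i)%:R * (a`!%:R * \prod_(i < r) v i ^+ m i) else 0)).
  apply: eq_bigr => i _ /=; rewrite -mulrA coef_XM mcoeffCM.
  case: ifPn => [mi|/negPn/eqP->]; last by rewrite mulr0 mul0r; case: ifP.
  rewrite (mfact_sub1 mi) natrM -mulrA (mulrCA (mfact _)%:R) IH.
  have -> : (mdeg (m - U_(i)) == a) = (mdeg m == a.+1).
    by rewrite -{2}(submK (_ : U_(i) <= m)%MM) ?lep1mP // mdegD mdeg1 addn1 eqSS.
  case: ifP => _; last by rewrite !mulr0.
  congr (_ * _); rewrite mulrCA; congr (_ * _).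
  rewrite (bigD1 i) //= [RHS](bigD1 i) //= mnmBE mnm1E eqxx subn1 mulrA -exprS prednK ?lt0n //.
  congr (_ * _); apply: eq_bigr => j ji.
  by rewrite mnmBE mnm1E eq_sym (negbTE ji) subn0.
case: eqP => [mE|_]; last by rewrite big1.
by rewrite -mulr_suml -natr_sum -mdegE mE factS natrM mulrA.
Qed.
End MultinomialPowers.

(** * The derivative in [x_mu] of a formal exponential *)

Section CoefficientwiseDerivative.
Variables (F : fieldType) (n r : nat).
Hypothesis charF0 : [pchar F] =i pred0.
Local Notation S := {mpoly F[n]}.
Implicit Types x y : {mpoly S[r]}.

Lemma map_mderivM mu x y :
  map_mpoly (mderiv mu) (x * y) =
  map_mpoly (mderiv mu) x * y + x * map_mpoly (mderiv mu) y.
Proof.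
apply/mpolyP => m; rewrite mcoeffD mcoeff_map_mpoly !mcoeffM raddf_sum -big_split.
by apply: eq_bigr => k _; rewrite /= mderivM !mcoeff_map_mpoly.
Qed.

Lemma map_mderiv_expn mu x a :
  map_mpoly (mderiv mu) (x ^+ a.+1) = (map_mpoly (mderiv mu) x * x ^+ a) *+ a.+1.
Proof.
elim: a => [|a IH]; first by rewrite expr1 mulr1.
rewrite exprS map_mderivM IH mulrnAr mulrCA -exprS.
by rewrite -mulrS.
Qed.

Lemma map_mderiv_expt mu x N :
  map_mpoly (mderiv mu) (expt N.+1 x) = map_mpoly (mderiv mu) x * expt N x.
Proof.
have dscal c y : map_mpoly (mderiv mu) (scal S r c * y) = scal S r c * map_mpoly (mderiv mu) y.
  by apply/mpolyP => m; rewrite [LHS]mcoeff_map_mpoly !coef_scalM [RHS]/= mcoeff_map_mpoly -mderivZ.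
rewrite /expt raddf_sum big_nat_recl //= dscal expr0.
have -> : map_mpoly (mderiv mu) (1 : {mpoly S[r]}) = 0.
  by rewrite -mpolyC1 map_mpolyC /= -mpolyC1 mderivC mpolyC0.
rewrite mulr0 add0r mulr_sumr; apply: eq_bigr => a _.
have -> : scal S r (a`!%:R)^-1 = scal S r (a.+1`!%:R)^-1 *+ a.+1.
  rewrite -raddfMn /= factS natrM invfM -[_ *+ a.+1]mulr_natr mulrAC mulVf ?mul1r //.
  exact: natf_neq0_char0.
by rewrite dscal map_mderiv_expn mulrnAl !mulrnAr mulrCA.
Qed.

Lemma map_mderiv_lin_gen mu (d : 'I_n -> {mpoly F[r]}) :
  map_mpoly (mderiv mu) (lin_gen (fun i => 'X_i : S) d) = map_mpoly (in_alg S) (d mu).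
Proof.
apply/mpolyP => m; rewrite [LHS]mcoeff_map_mpoly [RHS]mcoeff_map_mpoly coef_lin_gen.
rewrite raddf_sum (bigD1 mu) //= mderivZ mderivX mnm1E eqxx scale1r.
have -> : (U_(mu) - U_(mu) = 0 :> 'X_{1..n})%MM.
  by apply/mnmP => i; rewrite mnmBE subnn mnm0E.
rewrite mpolyX0 big1 ?addr0 // => i imu.
by rewrite mderivZ mderivX mnm1E (negbTE imu) scale0r scaler0.
Qed.

(** Differentiation shortens the truncation by one term; the truncations at [N] and [N + 1] differ
    only in order above [N], so the exact formula [map_mderiv_expt] becomes one with [N] on both
    sides. *)
Lemma map_mderiv_exp_gen mu (d : 'I_n -> {mpoly F[r]}) N :
  (forall i, low 1 (d i)) ->
  eqlow N.+1 (map_mpoly (mderiv mu) (expt N (lin_gen (fun i => 'X_i : S) d)))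
    (map_mpoly (in_alg S) (d mu) * expt N (lin_gen (fun i => 'X_i : S) d)).
Proof.
move=> dl; set x := lin_gen _ d.
have mlow p : low 1 p -> low 1 (map_mpoly (in_alg S) p).
  by move=> pl m m1; rewrite mcoeff_map_mpoly pl // raddf0.
have xl : low 1 x by apply: low_sum => i _; apply/lowMr/mlow.
have H : eqlow N.+1 (map_mpoly (mderiv mu) (expt N.+1 x))
                    (map_mpoly (mderiv mu) (expt N x)).
  rewrite /eqlow -raddfB /expt big_nat_recr //= addrAC subrr add0r => m mN.
  rewrite mcoeff_map_mpoly coef_scalM (_ : (x ^+ N.+1)@_m = 0) ?scaler0 ?raddf0 //.
  exact: (@lowX _ _ N.+1 x xl).
apply: (eqlow_trans (eqlow_sym H)); rewrite map_mderiv_expt map_mderiv_lin_gen.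
exact: eqlow_refl.
Qed.

End CoefficientwiseDerivative.

(** * Exponents in the two families of variables [k] and [q] *)

Section JoinedMultinomials.
Variable n : nat.
Implicit Types (I J : 'X_{1..n}) (k : 'X_{1..n + n}).

Definition mleft k : 'X_{1..n} := [multinom k (lshift n i) | i < n].
Definition mright k : 'X_{1..n} := [multinom k (rshift n i) | i < n].

Lemma mjoin_lshift I J i : mjoin I J (lshift n i) = I i.
Proof. by rewrite mnmE (unsplitK (inl _ i)). Qed.

Lemma mjoin_rshift I J i : mjoin I J (rshift n i) = J i.
Proof. by rewrite mnmE (unsplitK (inr _ i)). Qed.

Lemma mjoinK k : mjoin (mleft k) (mright k) = k.
Proof.
by apply/mnmP => i; case: (split_ordP i) => j ->; rewrite ?mjoin_lshift ?mjoin_rshift mnmE.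
Qed.

Lemma mleft_join I J : mleft (mjoin I J) = I.
Proof. by apply/mnmP => i; rewrite mnmE mjoin_lshift. Qed.

Lemma mright_join I J : mright (mjoin I J) = J.
Proof. by apply/mnmP => i; rewrite mnmE mjoin_rshift. Qed.

Lemma mdeg_join I J : mdeg (mjoin I J) = (mdeg I + mdeg J)%N.
Proof.
by rewrite !mdegE big_split_ord /=; congr addn; apply: eq_bigr => i _;
   rewrite ?mjoin_lshift ?mjoin_rshift.
Qed.

Lemma mfact_join I J : mfact (mjoin I J) = (mfact I * mfact J)%N.
Proof.
by rewrite /mfact big_split_ord /=; congr muln; apply: eq_bigr => i _;
   rewrite ?mjoin_lshift ?mjoin_rshift.
Qed.

Lemma mjoinD I J I' J' : (mjoin I J + mjoin I' J' = mjoin (I + I') (J + J'))%MM.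
Proof.
by apply/mnmP => i; case: (split_ordP i) => j ->;
   rewrite mnmDE ?mjoin_lshift ?mjoin_rshift mnmDE.
Qed.

Lemma mjoinB I J I' J' : (mjoin I J - mjoin I' J' = mjoin (I - I') (J - J'))%MM.
Proof.
by apply/mnmP => i; case: (split_ordP i) => j ->;
   rewrite mnmBE ?mjoin_lshift ?mjoin_rshift mnmBE.
Qed.

Lemma mjoin_le I J I' J' : (mjoin I J <= mjoin I' J')%MM = (I <= I')%MM && (J <= J')%MM.
Proof.
apply/mnm_lepP/andP => [H|[/mnm_lepP H1 /mnm_lepP H2] i].
  split; apply/mnm_lepP => i; first by have := H (lshift n i); rewrite !mjoin_lshift.
  by have := H (rshift n i); rewrite !mjoin_rshift.
by case: (split_ordP i) => j ->; rewrite ?mjoin_lshift ?mjoin_rshift.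
Qed.

Lemma lem_mdeg I J : (I <= J)%MM -> (mdeg I <= mdeg J)%N.
Proof. by move=> /submK <-; rewrite mdegD leq_addl. Qed.

Lemma sum_mjoin (V : nmodType) (b1 b2 : nat) I J (f : 'X_{1..n + n} -> V) :
  (mdeg I < b1)%N -> (mdeg J < b2)%N ->
  \sum_(k : 'X_{1..(n + n)%N < (b1 + b2)%N} | (k <= mjoin I J)%MM) f k =
  \sum_(I' : 'X_{1..n < b1} | (I' <= I)%MM)
    \sum_(J' : 'X_{1..n < b2} | (J' <= J)%MM) f (mjoin I' J').
Proof.
move=> Ib Jb; rewrite pair_big /=.
have hP (p : 'X_{1..n < b1} * 'X_{1..n < b2}) : (mdeg (mjoin p.1 p.2) < b1 + b2)%N.
  by rewrite mdeg_join; have := bmdeg p.1; have := bmdeg p.2; lia.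
(* The inverse map must respect the bounds for every [k]; outside the summation condition the
   default values [I] and [J] do. *)
have hI k : (mdeg (if (k <= mjoin I J)%MM then mleft k else I) < b1)%N.
  case: ifP => //; rewrite -{1}(mjoinK k) mjoin_le => /andP[/lem_mdeg kI _].
  exact: leq_ltn_trans kI Ib.
have hJ k : (mdeg (if (k <= mjoin I J)%MM then mright k else J) < b2)%N.
  case: ifP => //; rewrite -{1}(mjoinK k) mjoin_le => /andP[_ /lem_mdeg kJ].
  exact: leq_ltn_trans kJ Jb.
rewrite (reindex_onto (fun p : 'X_{1..n < b1} * 'X_{1..n < b2} => BMultinom (hP p))
  (fun k : 'X_{1..(n + n)%N < (b1 + b2)%N} => (BMultinom (hI k), BMultinom (hJ k)))) /=.
  apply: eq_bigl => -[I' J'] /=; rewrite -mjoin_le andb_idr // => le.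
  by apply/eqP; congr pair; apply: val_inj; rewrite /= le ?mleft_join ?mright_join.
by move=> k kI; apply: val_inj; rewrite /= kI mjoinK.
Qed.
End JoinedMultinomials.

(** * The deformed coproduct *)
Section HausdorffCoproduct.
Variables (F : fieldType) (n : nat) (c : 'I_n -> 'I_n -> 'I_n -> F).
Variables (A : algType F) (iota : 'I_n -> A) (D : nat -> 'I_n -> {mpoly F[n + n]}).
Hypothesis charF0 : [pchar F] =i pred0.
Hypothesis cP : lie_structure_constants c.
Hypothesis AP : is_enveloping c iota.
Hypothesis DP : is_D iota D.
Local Notation S := {mpoly F[n]}.
Local Notation X := (fun i : 'I_n => 'X_i : S).
Local Notation K := (Kv iota).
Local Notation Q := (Qv iota).

Lemma var_homog i (a : A) : ('X_i * a%:MP : {mpoly A[n + n]}) \is 1.-homog.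
Proof. by rewrite -commr_mpolyX mul_mpolyC; apply: dhomogZ; rewrite dhomogX /= mdeg1. Qed.

Lemma Kv_homog : K \is 1.-homog.
Proof. by apply: rpred_sum => i _; apply: var_homog. Qed.

Lemma Qv_homog : Q \is 1.-homog.
Proof. by apply: rpred_sum => i _; apply: var_homog. Qed.

Lemma homog_low (p : {mpoly A[n + n]}) N : p \is N.-homog -> low N p.
Proof. by move=> pN m mN; apply: (dhomog_nemf_coeff pN); rewrite neq_ltn mN. Qed.

Lemma ev_homog w : eval_word K Q w \is (size w).-homog.
Proof.
elim: w => [|b w IH]; first by rewrite /eval_word big_nil dhomog1.
rewrite /eval_word big_cons -[size _]/(1 + size w)%N; apply: dhomogM => //.
by case: b; [apply: Kv_homog|apply: Qv_homog].
Qed.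

Lemma HevalE P : Heval iota P = eval_words K Q (hcoefF charF0) P.
Proof. by apply: eq_bigr => w _; rewrite /eval_word big_tuple. Qed.

Lemma Heval_homog P : Heval iota P \is P.-homog.
Proof.
rewrite HevalE; apply: rpred_sum => w _; rewrite /scal mul_mpolyC.
by apply: dhomogZ; rewrite -{2}(size_tuple w); apply: ev_homog.
Qed.

(** [D P] is given only through an identity in [U(g)]; independence of the generators transfers the
    homogeneity of [Heval P] to it, coefficient by coefficient. *)
Lemma D_homog P mu m : (0 < P)%N -> mdeg m != P -> (D P mu)@_m = 0.
Proof.
move=> P0 mP; apply: (iota_free charF0 cP AP (a := fun mu => (D P mu)@_m)).
rewrite -[RHS](dhomog_nemf_coeff (Heval_homog P) mP) DP // raddf_sum.
by apply: eq_bigr => i _; rewrite /= coef_map_algMC.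
Qed.

Definition Dsum N mu : {mpoly F[n + n]} := \sum_(1 <= P < N.+1) D P mu.

Lemma Dsum_low N mu : low 1 (Dsum N mu).
Proof.
move=> m m1; rewrite raddf_sum big_nat big1 // => P /andP[P1 _] /=.
by apply: D_homog => //; lia.
Qed.

(** By homogeneity only [P = |I| + |J|] contributes to the coefficient of [k^I q^J], and nothing
    does in degree 0. *)
Lemma Dser_Dsum N mu I J : (mdeg I + mdeg J <= N)%N ->
  Dser D mu I J = (Dsum N mu)@_(mjoin I J).
Proof.
move=> IJN; rewrite /Dser; case: ifPn => [IJ0|]; last first.
  by rewrite -leqNgt leqn0 => /eqP IJ0; rewrite Dsum_low // mdeg_join IJ0.
rewrite /Dsum raddf_sum (bigD1_seq (mdeg I + mdeg J)%N) ?iota_uniq //=; last first.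
  by rewrite mem_index_iota IJ0.
rewrite big1_seq ?addr0 // => P /andP[PIJ]; rewrite mem_index_iota => /andP[P1 _].
by apply: D_homog; rewrite // mdeg_join eq_sym.
Qed.

Definition varK (i : 'I_n) : {mpoly F[n + n]} := 'X_(lshift n i).
Definition varQ (i : 'I_n) : {mpoly F[n + n]} := 'X_(rshift n i).

Lemma KvE : K = lin_gen iota varK.
Proof. by apply: eq_bigr => i _; rewrite map_mpolyX. Qed.

Lemma QvE : Q = lin_gen iota varQ.
Proof. by apply: eq_bigr => i _; rewrite map_mpolyX. Qed.

Lemma sum_Heval N : \sum_(1 <= P < N.+1) eval_words K Q (hcoefF charF0) P = lin_gen iota (Dsum N).
Proof.
under eq_big_nat => P /andP[P0 _] do rewrite -HevalE DP //.
rewrite exchange_big; apply: eq_bigr => i _.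
by rewrite -mulr_suml -raddf_sum.
Qed.

Lemma coef_exp_var (v : 'I_n + 'I_n -> S) N m : (mdeg m <= N)%N ->
  (mfact m)%:R *: (expt N (\sum_(i < n + n) 'X_i * (v (split i))%:MP))@_m =
  \prod_(i < n + n) v (split i) ^+ m i.
Proof.
move=> mN; rewrite coef_expt scaler_sumr.
have scale_nat k (x : S) : (k%:R : F) *: x = k%:R * x by rewrite scaler_nat mulr_natl.
under eq_bigr do rewrite scalerA mulrC -scalerA scale_nat coef_linear_expn.
rewrite (bigD1_seq (mdeg m)) ?iota_uniq ?mem_index_iota //= eqxx -scale_nat.
rewrite scalerA mulVf ?fact_neq0_char0 // scale1r [X in _ + X]big1 ?addr0 // => a am.
by rewrite eq_sym (negbTE am) scaler0.
Qed.

Lemma coef_exp_varK N I J : (mdeg I + mdeg J <= N)%N ->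
  (mfact I * mfact J)%:R *: (expt N (lin_gen X varK))@_(mjoin I J) =
  if J == 0%MM then 'X_[I] else 0.
Proof.
move=> IJN; pose v (i : 'I_n + 'I_n) : S := if i is inl a then 'X_a else 0.
have -> : lin_gen X varK = \sum_(i < n + n) 'X_i * (v (split i))%:MP.
  rewrite big_split_ord /= [X in _ + X]big1 ?addr0 => [|i _].
    by apply: eq_bigr => i _; rewrite map_mpolyX (unsplitK (inl _ i)).
  by rewrite (unsplitK (inr _ i)) mpolyC0 mulr0.
rewrite -mfact_join coef_exp_var ?mdeg_join // big_split_ord /=.
under eq_bigr do rewrite (unsplitK (inl _ _)) mjoin_lshift.
rewrite -mpolyXE_id.
under eq_bigr do rewrite (unsplitK (inr _ _)) mjoin_rshift /=.
case: eqP => [->|/eqP J0]; first by rewrite big1 ?mulr1 // => i _; rewrite mnm0E.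
have [j /andP[Jj _]] := least_var_ex J0.
by rewrite (bigD1 j) //= expr0n (negbTE Jj) mul0r mulr0.
Qed.

Lemma coef_exp_varQ N I J : (mdeg I + mdeg J <= N)%N ->
  (mfact I * mfact J)%:R *: (expt N (lin_gen X varQ))@_(mjoin I J) =
  if I == 0%MM then 'X_[J] else 0.
Proof.
move=> IJN; pose v (i : 'I_n + 'I_n) : S := if i is inr a then 'X_a else 0.
have -> : lin_gen X varQ = \sum_(i < n + n) 'X_i * (v (split i))%:MP.
  rewrite big_split_ord /= [X in X + _]big1 ?add0r => [|i _].
    by apply: eq_bigr => i _; rewrite map_mpolyX (unsplitK (inr _ i)).
  by rewrite (unsplitK (inl _ i)) mpolyC0 mulr0.
rewrite -mfact_join coef_exp_var ?mdeg_join // big_split_ord /=.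
under eq_bigr do rewrite (unsplitK (inl _ _)) mjoin_lshift /=.
under [X in _ * X]eq_bigr do rewrite (unsplitK (inr _ _)) mjoin_rshift.
rewrite -mpolyXE_id.
case: eqP => [->|/eqP I0]; first by rewrite big1 ?mul1r // => i _; rewrite mnm0E.
have [j /andP[Ij _]] := least_var_ex I0.
by rewrite (bigD1 j) //= expr0n (negbTE Ij) !mul0r.
Qed.

(* The coefficient of [k^I q^J] in [exp (\sum_mu D^mu(k, q) x_mu)], that is,
   [x^I * x^J / (I! J!)] for the star product. *)
Definition exp_coef N I J : S := (expt N (lin_gen X (Dsum N)))@_(mjoin I J).

Lemma mfact_neq0 r (m : 'X_{1..r}) : (mfact m)%:R != 0 :> F.
Proof. by apply: natf_neq0_char0 => //; rewrite -lt0n prodn_gt0 // => i; apply: fact_gt0. Qed.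

Lemma mfact0 : mfact (0%MM : 'X_{1..n}) = 1%N.
Proof. by rewrite /mfact big1 // => i _; rewrite mnm0E. Qed.

(** By [xi_expt] and [exp_hausdorff], [xi] maps [exp_coef] to the coefficient of [k^I q^J] in
    [exp K exp Q]. *)
Lemma xi_exp_coef N I J : (mdeg I + mdeg J <= N)%N ->
  (mfact I * mfact J)%:R *: xi iota (exp_coef N I J) = xi iota 'X_[I] * xi iota 'X_[J].
Proof.
move=> IJN; rewrite xi_expt //.
have := exp_hausdorff charF0 (homog_low Kv_homog) (homog_low Qv_homog) (N := N).
rewrite sum_Heval KvE QvE => /eqlow_coeff->; last by rewrite mdeg_join.
rewrite mcoeffM.
have kb (I' J' : 'X_{1..n}) : (I' <= I)%MM -> (J' <= J)%MM ->
    (mdeg (mjoin I' J') < (mdeg (mjoin I J)).+1)%N.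
  by move=> I'I J'J; rewrite ltnS lem_mdeg // mjoin_le I'I.
have le0 (I' : 'X_{1..n}) : (0 <= I')%MM by apply/mnm_lepP => i; rewrite mnm0E.
pose k1 := BMultinom (kb I 0%MM (lepm_refl I) (le0 J)).
pose k2 := BMultinom (kb 0%MM J (le0 I) (lepm_refl J)).
have coefK (k : 'X_{1..n + n}) : (mdeg k <= N)%N -> mright k != 0%MM ->
    (expt N (lin_gen iota varK))@_k = 0.
  move=> kN k0; rewrite -xi_expt //.
  have := @coef_exp_varK N (mleft k) (mright k); rewrite -mdeg_join mjoinK => /(_ kN).
  rewrite (negbTE k0) => /eqP; rewrite scaler_eq0 natrM mulf_eq0 !(negbTE (mfact_neq0 _)) /=.
  by move=> /eqP->; rewrite raddf0.
have coefQ (k : 'X_{1..n + n}) : (mdeg k <= N)%N -> mleft k != 0%MM ->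
    (expt N (lin_gen iota varQ))@_k = 0.
  move=> kN k0; rewrite -xi_expt //.
  have := @coef_exp_varQ N (mleft k) (mright k); rewrite -mdeg_join mjoinK => /(_ kN).
  rewrite (negbTE k0) => /eqP; rewrite scaler_eq0 natrM mulf_eq0 !(negbTE (mfact_neq0 _)) /=.
  by move=> /eqP->; rewrite raddf0.
(* [exp K] involves no [q] and [exp Q] no [k], so [k^I] times [q^J] is the only splitting that
   survives. *)
rewrite (bigD1 (k1, k2)) /=; last by rewrite mjoinD addm0 add0m.
rewrite big1 ?addr0 => [|[m1 m2] /= /andP[/eqP mE neq]].
  have EK : (mfact I)%:R *: (expt N (lin_gen iota varK))@_(mjoin I 0%MM) = xi iota 'X_[I].
    have := @coef_exp_varK N I 0%MM; rewrite mfact0 muln1 mdeg0 addn0 eqxx => <-.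
      by rewrite linearZ /= xi_expt.
    by apply: leq_trans IJN; rewrite leq_addr.
  have EQ : (mfact J)%:R *: (expt N (lin_gen iota varQ))@_(mjoin 0%MM J) = xi iota 'X_[J].
    have := @coef_exp_varQ N 0%MM J; rewrite mfact0 mul1n mdeg0 add0n eqxx => <-.
      by rewrite linearZ /= xi_expt.
    by apply: leq_trans IJN; rewrite leq_addl.
  by rewrite -EK -EQ -scalerAl -scalerAr scalerA natrM.
have mN (m : 'X_{1..(n + n)%N < (mdeg (mjoin I J)).+1}) : (mdeg m <= N)%N.
  by apply: leq_trans IJN; rewrite -mdeg_join -ltnS; apply: bmdeg.
have [r1|r1] := eqVneq (mright m1) 0%MM; last by rewrite coefK ?mul0r.
have [l2|l2] := eqVneq (mleft m2) 0%MM; last by rewrite coefQ ?mulr0.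
move: mE neq; rewrite -(mjoinK m1) -(mjoinK m2) r1 l2 mjoinD addm0 add0m => mE.
have IE := congr1 (@mleft n) mE; have JE := congr1 (@mright n) mE.
rewrite !mleft_join in IE; rewrite !mright_join in JE.
case/eqP; congr pair; apply: val_inj => /=.
  by rewrite -(mjoinK m1) r1 -IE.
by rewrite -(mjoinK m2) l2 -JE.
Qed.

(** [star] is chosen by [epsilon], so a preimage under [xi] has to be exhibited: on monomials it is
    a multiple of [exp_coef], and bilinearity does the rest. *)
Lemma xi_star f g : xi iota (star iota f g) = xi iota f * xi iota g.
Proof.
rewrite /star /xi_inv; apply: (epsilon_spec (inhabits 0) (fun p => xi iota p = _)).
elim/mpolyind: f => [|a I f _ _ [p pE]].
  by exists 0; rewrite linear0 mul0r.
suff [q qE] : exists q, xi iota q = xi iota 'X_[I] * xi iota g.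
  by exists (a *: q + p); rewrite !linearP /= qE pE mulrDl -scalerAl.
elim/mpolyind: g {p pE} => [|b J g _ _ [p pE]].
  by exists 0; rewrite linear0 mulr0.
exists (b *: ((mfact I * mfact J)%:R *: exp_coef (mdeg I + mdeg J) I J) + p).
by rewrite !linearP /= linearZ /= xi_exp_coef // pE mulrDr -scalerAr.
Qed.

Lemma starX N I J : (mdeg I + mdeg J <= N)%N ->
  star iota 'X_[I] 'X_[J] = (mfact I * mfact J)%:R *: exp_coef N I J.
Proof.
move=> IJN; apply: (xi_inj charF0 cP AP).
by rewrite xi_star linearZ /= xi_exp_coef.
Qed.

(** The value of [star] comes from a choice, so linearity is checked after applying the injective
    [xi]. *)
Fact starl_linear g : linear (star iota ^~ g).
Proof.
move=> a f f'; apply: (xi_inj charF0 cP AP).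
by rewrite linearP /= !xi_star linearP /= mulrDl scalerAl.
Qed.

Fact starr_linear f : linear (star iota f).
Proof.
move=> a g g'; apply: (xi_inj charF0 cP AP).
by rewrite linearP /= !xi_star linearP /= mulrDr scalerAr.
Qed.

Lemma mderivmX_mfact (I I' : 'X_{1..n}) :
  (mfact (I - I'))%:R *: mderivm I' ('X_[I] : S) =
  if (I' <= I)%MM then (mfact I)%:R *: 'X_[I - I'] else 0.
Proof.
rewrite mderivmX scalerA -natrM; case: ifPn => [/mnm_lepP I'I|].
  congr (_%:R *: _); rewrite /mfact -big_split; apply: eq_bigr => i _ /=.
  by rewrite mnmBE mulnC ffact_fact.
rewrite negb_forall => /existsP[i]; rewrite -ltnNge => iI.
by rewrite [X in (_ * X)%N](bigD1 i) //= ffact_small // mul0n muln0 scale0r.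
Qed.

(** The factorials of [I - I'] and [J - J'] produced by [starX] cancel against the derivatives; the
    remaining factor is independent of [I'] and [J'] and comes out of the coproduct sum. *)
Lemma star_mderivm N I J I' J' : (mdeg I + mdeg J <= N)%N ->
  star iota (mderivm I' 'X_[I]) (mderivm J' 'X_[J]) =
  if (I' <= I)%MM && (J' <= J)%MM
  then (mfact I * mfact J)%:R *: exp_coef N (I - I') (J - J') else 0.
Proof.
have sZl a f g : star iota (a *: f) g = a *: star iota f g.
  by apply: (xi_inj charF0 cP AP); rewrite linearZ /= !xi_star linearZ /= scalerAl.
have sZr a f g : star iota f (a *: g) = a *: star iota f g.
  by apply: (xi_inj charF0 cP AP); rewrite linearZ /= !xi_star linearZ /= scalerAr.
have s0l g : star iota 0 g = 0 by have := sZl 0 0 g; rewrite !scale0r.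
have s0r f : star iota f 0 = 0 by have := sZr 0 f 0; rewrite !scale0r.
move=> IJN.
have divf m (p q : S) : (mfact m)%:R *: p = q -> p = (mfact (m : 'X_{1..n}))%:R^-1 *: q :> S.
  by move<-; rewrite scalerA mulVf ?scale1r ?mfact_neq0.
rewrite (divf _ _ _ (mderivmX_mfact I I')) (divf _ _ _ (mderivmX_mfact J J')).
rewrite sZl sZr; case: ifP => I'I; last by rewrite s0l !scaler0.
case: ifP => J'J /=; last by rewrite s0r !scaler0.
rewrite sZl sZr (@starX N); last first.
  by apply: leq_trans IJN; apply: leq_add; apply: mdegB.
rewrite !scalerA; congr (_ *: _); rewrite !natrM.
by field; rewrite !mfact_neq0.
Qed.

(** The derivative multiplies the exponential by [D^mu(k,q)]; the coefficient of [k^I q^J] is then a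
    convolution over the pairs below [(I, J)]. The bounds [b1] and [b2] are free, so that one range
    fits all monomials of two polynomials. *)
Lemma mderiv_exp_coef N mu I J b1 b2 :
  (mdeg I + mdeg J <= N)%N -> (mdeg I < b1)%N -> (mdeg J < b2)%N ->
  mderiv mu (exp_coef N I J) =
  \sum_(I' : 'X_{1..n < b1} | (I' <= I)%MM) \sum_(J' : 'X_{1..n < b2} | (J' <= J)%MM)
    Dser D mu I' J' *: exp_coef N (I - I') (J - J').
Proof.
move=> IJN Ib Jb.
have := map_mderiv_exp_gen charF0 mu (@Dsum_low N) (N := N).
move=> H; have := @eqlow_coeff _ _ _ _ _ (mjoin I J) H; rewrite mdeg_join ltnS => /(_ IJN).
rewrite mcoeff_map_mpoly => ->.
rewrite (@mcoeff_poly_mul_lin _ _ _ _ _ (b1 + b2)); last by rewrite mdeg_join; lia.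
rewrite (sum_mjoin (fun k => (map_mpoly (in_alg S) (Dsum N mu))@_k *
  (expt N (lin_gen X (Dsum N)))@_(mjoin I J - k)) Ib Jb).
apply: eq_bigr => I' I'I; apply: eq_bigr => J' J'J.
rewrite mcoeff_map_mpoly /= -scalerAl mul1r mjoinB (@Dser_Dsum N) //.
by apply: leq_trans IJN; apply: leq_add; apply: lem_mdeg.
Qed.

Lemma coproduct_mon mu I J b1 b2 : (mdeg I < b1)%N -> (mdeg J < b2)%N ->
  mderiv mu (star iota 'X_[I] 'X_[J]) =
  \sum_(I' : 'X_{1..n < b1}) \sum_(J' : 'X_{1..n < b2})
    Dser D mu I' J' *: star iota (mderivm I' 'X_[I]) (mderivm J' 'X_[J]).
Proof.
move=> Ib Jb; pose N := (mdeg I + mdeg J)%N.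
rewrite (@starX N) // mderivZ (mderiv_exp_coef mu (leqnn N) Ib Jb) scaler_sumr.
rewrite big_mkcond; apply: eq_bigr => I' _; case: ifPn => I'I; last first.
  rewrite big1 // => J' _; rewrite (@star_mderivm N) // (negbTE I'I) scaler0 //.
rewrite scaler_sumr big_mkcond; apply: eq_bigr => J' _.
rewrite (@star_mderivm N) // I'I /=; case: ifP => _; last by rewrite scaler0.
by rewrite scalerA mulrC -scalerA.
Qed.

Lemma Dser_coproduct mu : is_coproduct iota mu (Dser D mu).
Proof.
move=> f g; set b1 := msize f; set b2 := msize g.
pose L (f g : S) := mderiv mu (star iota f g).
(* The ranges stay those of the given [f] and [g], which makes [R] bilinear. *)
pose R (f g : S) := \sum_(I : 'X_{1..n < b1}) \sum_(J : 'X_{1..n < b2})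
  Dser D mu I J *: star iota (mderivm I f) (mderivm J g).
have Ll g' : linear (L^~ g') by move=> a p q; rewrite /L starl_linear linearP /=.
have Lr f' : linear (L f') by move=> a p q; rewrite /L starr_linear linearP /=.
have Rl g' : linear (R^~ g').
  move=> a p q; rewrite /R scaler_sumr -big_split; apply: eq_bigr => I _ /=.
  rewrite scaler_sumr -big_split; apply: eq_bigr => J _ /=.
  by rewrite linearP /= starl_linear scalerDr !scalerA mulrC.
have Rr f' : linear (R f').
  move=> a p q; rewrite /R scaler_sumr -big_split; apply: eq_bigr => I _ /=.
  rewrite scaler_sumr -big_split; apply: eq_bigr => J _ /=.
  by rewrite linearP /= starr_linear scalerDr !scalerA mulrC.
rewrite -/(L f g) -/(R f g) (linear_mext (Ll g)) (linear_mext (Rl g)).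
apply: (@eq_mext_size _ _ _ _ _ _ b1) => // I Ib.
rewrite (linear_mext (Lr _)) (linear_mext (Rr _)).
by apply: (@eq_mext_size _ _ _ _ _ _ b2) => // J Jb; apply: coproduct_mon.
Qed.

(** On [x^I] and [x^J], pairs not below [(I, J)] are killed by the derivatives and smaller ones
    agree by induction; the difference of the two coefficients is left, times [I! J!] and [exp_coef]
    at zero. *)
Lemma coproduct_uniq mu cf1 cf2 : is_coproduct iota mu cf1 -> is_coproduct iota mu cf2 ->
  forall I J, cf1 I J = cf2 I J.
Proof.
move=> cf1P cf2P I J; have [d] := ubnP (mdeg I + mdeg J)%N.
elim: d I J => // d IH I J IJd.
have := cf1P 'X_[I] 'X_[J]; rewrite (cf2P 'X_[I] 'X_[J]) !msizeX => /eqP.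
rewrite -subr_eq0 -sumrB.
have Ib : (mdeg I < (mdeg I).+1)%N by []; have Jb : (mdeg J < (mdeg J).+1)%N by [].
pose N := (mdeg I + mdeg J)%N.
have E I' J' : (mdeg I' < (mdeg I).+1)%N -> (mdeg J' < (mdeg J).+1)%N ->
    (I' != I) || (J' != J) ->
    cf2 I' J' *: star iota (mderivm I' 'X_[I]) (mderivm J' 'X_[J]) -
    cf1 I' J' *: star iota (mderivm I' 'X_[I]) (mderivm J' 'X_[J]) = 0.
  move=> I'b J'b neq; rewrite (@star_mderivm N) //; case: ifP; last first.
    by rewrite !scaler0 subrr.
  case/andP=> I'I J'J; rewrite IH ?subrr //.
  have mI : mdeg I = (mdeg (I - I')%MM + mdeg I')%N by rewrite -mdegD submK.
  have mJ : mdeg J = (mdeg (J - J')%MM + mdeg J')%N by rewrite -mdegD submK.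
  have : (0 < mdeg (I - I')%MM + mdeg (J - J')%MM)%N.
    rewrite lt0n addn_eq0 negb_and !mdeg_eq0; apply: contraTT neq.
    rewrite negb_or !negbK => /andP[/eqP I0 /eqP J0].
    by rewrite -(submK I'I) I0 -(submK J'J) J0 !add0m !eqxx.
  lia.
rewrite (bigD1 (BMultinom Ib)) //= [X in _ + X]big1 ?addr0 => [|I' I'I]; last first.
  rewrite -sumrB big1 // => J' _; apply: E; rewrite ?bmdeg //.
  by move: I'I; rewrite bmeqP /= => ->.
rewrite -sumrB (bigD1 (BMultinom Jb)) //= [X in _ + X]big1 ?addr0 => [|J' J'J]; last first.
  by apply: E; rewrite ?bmdeg //; move: J'J; rewrite bmeqP /= => ->; rewrite orbT.
rewrite (@star_mderivm N) // !lepm_refl /= -scalerBl !scaler_eq0 => /orP[|/orP[|]].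
- by rewrite subr_eq0 => /eqP.
- by rewrite natrM mulf_eq0 !(negbTE (mfact_neq0 _)).
have subII (I' : 'X_{1..n}) : (I' - I' = 0)%MM.
  by apply/mnmP => i; rewrite mnmBE subnn mnm0E.
(* [exp_coef] at [(0, 0)] is nonzero because [xi] maps it to 1. *)
move=> /eqP/(congr1 (xi iota)); rewrite !subII linear0.
have := @xi_exp_coef N 0%MM 0%MM; rewrite mdeg0 mfact0 scale1r => -> //.
rewrite mpolyX0 => /eqP.
(* Read off the zeroth power of a linear element in no formal variables. *)
have -> : xi iota 1 = 1.
  have := @xi_lin_gen F n 0 A iota charF0 (fun _ => 0) 0 0%MM.
  by rewrite !expr0 !mcoeff1 eqxx.
by rewrite mulr1 oner_eq0.
Qed.
End HausdorffCoproduct.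

Theorem theorem7p2 (F : fieldType) (n : nat) (c : 'I_n -> 'I_n -> 'I_n -> F)
  (A : algType F) (iota : 'I_n -> A) (D : nat -> 'I_n -> {mpoly F[n + n]}) :
  [pchar F] =i pred0 ->
  lie_structure_constants c ->
  is_enveloping c iota ->
  is_D iota D ->
  forall mu : 'I_n,
    is_coproduct iota mu (Dser D mu) /\
    (forall cf, is_coproduct iota mu cf -> forall I J, cf I J = Dser D mu I J).
Proof.
move=> charF0 cP AP DP mu.
have H := Dser_coproduct charF0 cP AP DP mu.
by split=> // cf cfP I J; apply: (coproduct_uniq charF0 cP AP DP cfP H).
Qed.
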